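(* Let $\kappa$ be a regular uncountable cardinal. (a) If there is a $\le^*$-chain of length $\kappa$ (in ${}^\omega\omega$), then $\neg\mathrm C^{\mathrm s}(\kappa)$ and $\neg\hat{\mathrm C}^{\mathrm s}(\kappa)$. In particular, $\kappa\in\mathfrak S^\uparrow$ implies $\neg\mathrm C^{\mathrm s}(\kappa)$ and $\neg\hat{\mathrm C}^{\mathrm s}(\kappa)$. (This part is due to I. Juhász, L. Soukup and Z. Szentmiklóssy.) (b) $\mathrm C^{\mathrm s}(\kappa)$ (or $\hat{\mathrm C}^{\mathrm s}(\kappa)$) implies $\mathfrak b^\uparrow\le\kappa$. If $\mathfrak b^\uparrow$ is attained, then $\mathrm C^{\mathrm s}(\kappa)$ (or $\hat{\mathrm C}^{\mathrm s}(\kappa)$) implies $\mathfrak b^\uparrow<\kappa$. (c) If $\kappa\le\lambda$ for some $\lambda\in\mathfrak S^h$ with $\mathrm{cf}(\lambda)\ge\kappa$, then $\neg\mathrm C^{\mathrm s}(\kappa)$ and $\neg\hat{\mathrm C}^{\mathrm s}(\kappa)$. (d) If $\mathfrak S^h\cap\mathrm{Reg}$ is cofinal in $\mathfrak S^h$, then $\mathrm C^{\mathrm s}(\kappa)$ (or $\hat{\mathrm C}^{\mathrm s}(\kappa)$) implies $\mathfrak b^h\le\kappa$. If $\mathfrak b^h$ is regular and attained, then $\mathrm C^{\mathrm s}(\kappa)$ (or $\hat{\mathrm C}^{\mathrm s}(\kappa)$) implies $\mathfrak b^h<\kappa$. (e) $\kappa\in\mathfrak{DO}$ implies $\neg\mathrm{HP}(\kappa)$.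 (f) $\mathrm{HP}(\kappa)$ implies $\mathfrak{do}\le\kappa$. If $\mathfrak{do}$ is attained, then $\mathrm{HP}(\kappa)$ implies $\mathfrak{do}<\kappa$.
   Context: $\mathrm{Reg}$ is the class of regular cardinals. For $f,g\in{}^\omega\omega$, $f\le^* g$ means $f(n)\le g(n)$ for all but finitely many $n$. A $\le^*$-chain of length $\kappa$ is a sequence $\langle f_\alpha:\alpha<\kappa\rangle$ in ${}^\omega\omega$ that is strictly increasing, i.e. $f_\alpha\le^* f_\beta$ and $f_\beta\not\le^* f_\alpha$ for all $\alpha<\beta<\kappa$. In $\langle{}^\omega\omega,\le^*\rangle$, let $\mathfrak S^\uparrow=\{\mathrm{cf}(C): C\subseteq{}^\omega\omega$ is an unbounded $\le^*$-chain$\}$ (here a chain is a subset any two elements of which are $\le^*$-comparable) and $\mathfrak S^h=\{|X|: X\subseteq{}^\omega\omega$ and for all $B\subseteq X$, $B$ is $\le^*$-bounded iff $|B|<|X|\}$; $\mathfrak b^\uparrow=\sup\mathfrak S^\uparrow$ and $\mathfrak b^h=\sup\mathfrak S^h$. $\mathcal H(\aleph_1)$ is the set of hereditarily countable sets. A set $A\subseteq\mathcal H(\aleph_1)$ is definable if there are a formula $\varphi$ of the language of set theory and $a\in\mathcal H(\aleph_1)$ with $A=\{x\in\mathcal H(\aleph_1):\langle\mathcal H(\aleph_1),\in\rangle\models\varphi(x,a)\}$. $\mathfrak{DO}$ is the set of all $\mathrm{cf}(\mathrm{otp}(\langle X,R\restriction X\rangle))$ with $X\subseteq{}^\omega\omega$,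 $R$ a definable binary relation, and $R\cap X^2$ well-ordering $X$; $\mathfrak{do}=\sup\mathfrak{DO}$. Each of $\mathfrak b^\uparrow,\mathfrak b^h,\mathfrak{do}$ is said to be attained if the corresponding set ($\mathfrak S^\uparrow,\mathfrak S^h,\mathfrak{DO}$) has a maximal element. For a set $X$, $((X))^n$ is the set of injective $n$-tuples of elements of $X$, $((X))^{<\omega}=\bigcup_{n<\omega}((X))^n$, and $((X_0,\dots,X_{n-1}))$ is the set of injective tuples in $X_0\times\cdots\times X_{n-1}$. $f''S$ is the image of $S$ under $f$; ${}^{\omega>}\omega$ is the set of finite sequences of natural numbers, $|t|$ is the length of $t$; an intersection of subsets of $\omega$ over an empty index set is $\omega$. $\mathrm{HP}(\kappa)$: for any $f:\kappa\to\mathcal P(\omega)$ and any definable $A\subseteq((\mathcal P(\omega)))^{<\omega}$, at least one of the following holds: (h0) there is a stationary $S\subseteq\kappa$ such that $((f''S))^{<\omega}\setminus\{\emptyset\}\subseteq A$; (h1) there are $k\in\omega\setminus\{0\}$ and stationary $S_0,\dots,S_{k-1}\subseteq\kappa$ such that $((f''S_0,\dots,f''S_{k-1}))\cap A=\emptyset$. $\mathrm C^{\mathrm s}(\kappa)$: for any matrix $\langle a_{\alpha,n}:\alpha\in\kappa,n\in\omega\rangle$ of subsets of $\omega$ and any $T\subseteq{}^{\omega>}\omega$, at least one of the following holds: (c0) there is a stationary $S\subseteq\kappa$ such that $\bigcap_{n<|t|}a_{\alpha_n,t(n)}\neq\emptyset$ for all $t\in T$ and $\langle\alpha_0,\dots,\alpha_{|t|-1}\rangle\in((S))^{|t|}$;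 (c1) there are $t\in T$ and stationary $S_0,\dots,S_{|t|-1}\subseteq\kappa$ such that $\bigcap_{n<|t|}a_{\alpha_n,t(n)}=\emptyset$ for all $\langle\alpha_0,\dots,\alpha_{|t|-1}\rangle\in((S_0,\dots,S_{|t|-1}))$. $\hat{\mathrm C}^{\mathrm s}(\kappa)$: for any such matrix and $T$, at least one of the following holds: (ĉ0) there is a stationary $S\subseteq\kappa$ such that $\bigcap_{n<|t|}a_{\alpha_n,t(n)}$ is finite for every $t\in T$ and $\langle\alpha_0,\dots,\alpha_{|t|-1}\rangle\in((S))^{|t|}$; (ĉ1) there are $t\in T$ and stationary $S_0,\dots,S_{|t|-1}\subseteq\kappa$ such that $\bigcap_{n<|t|}a_{\alpha_n,t(n)}$ is infinite for every $\langle\alpha_0,\dots,\alpha_{|t|-1}\rangle\in((S_0,\dots,S_{|t|-1}))$. *)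

(* Defs.v *)
From mathcomp Require Import all_boot.
From mathcomp Require Import boolp classical_sets functions cardinality wochoice.

Set Implicit Arguments.
Unset Strict Implicit.
Unset Printing Implicit Defensive.

Local Open Scope classical_set_scope.
Local Open Scope card_scope.

(* Ordinals are well-ordered types and cardinals are initial ordinals; both are
   meant up to isomorphism.  Hence equality of cardinals is equipotence, and
   comparison of cardinals is existence of an injection.
   [well_order] (from wochoice.v) concerns the reflexive order, and implies that
   it is a total order. *)
Record Ord := MkOrd {
  ord_car :> Type;
  ole : rel ord_car;
  ole_wo : well_order ole }.
Arguments ole {o}.

Definition olt (o : Ord) (x y : o) : Prop := ole x y /\ x <> y.

Record Card := MkCard {
  card_ord :> Ord;
  card_initial : forall x : card_ord,
    ~ ([set: card_ord] #<= [set y | olt y x]) }.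

Definition cle (k l : Card) : Prop := [set: k] #<= [set: l].
Definition clt (k l : Card) : Prop := ~ cle l k.
Definition ceq (k l : Card) : Prop := [set: k] #= [set: l].

Lemma void_wo : @well_order void (fun _ _ => true).
Proof. by move=> A [[]]. Qed.

Lemma void_initial (x : MkOrd void_wo) :
  ~ ([set: MkOrd void_wo] #<= [set y | olt y x]).
Proof. by case: x. Qed.

Definition card0 : Card := MkCard void_initial.

Definition is_least (P : set Card) (k : Card) : Prop :=
  P k /\ forall l, P l -> cle k l.

(* The least cardinal in the class [P] (and 0 if there is none). *)
Definition card_min (P : set Card) : Card :=
  match pselect (exists k, is_least P k) with
  | left h => sval (cid h)
  | right _ => card0
  end.

Lemma card_leT_inj T U (f : T -> U) : injective f -> [set: T] #<= [set: U].
Proof.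
move=> finj; have [g] : $|{injfun [set: T] >-> [set: U]}|.
  by apply/injfunPex; exists f => // x y _ _; exact: finj.
exact: inj_card_le g.
Qed.

Lemma least_inj (I : Type) (F : I -> Type) (i0 : I) :
  exists i, forall j, [set: F i] #<= [set: F j].
Proof.
pose T := forall i, F i.
pose P : set (set T) := [set Z | forall i z w, Z z -> Z w -> z i = w i -> z = w].
have [G GP Gtot|A [PA maxA]] := @Zorn_bigcup T P.
  move=> i z w [X GX Xz] [Y GY Yw] e.
  case: (Gtot X Y GX GY) => s; first exact: (GP Y GY i z w (s _ Xz) Yw e).
  exact: (GP X GX i z w Xz (s _ Yw) e).
have [i hi] : exists i, forall u : F i, exists z, A z /\ z i = u.
  apply: contrapT => H.
  have nu i : {u : F i | forall z, A z -> z i <> u}.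
    apply: cid; apply: contrapT => Hu; apply: H; exists i => u.
    apply: contrapT => Hz; apply: Hu; exists u => z Az e.
    by apply: Hz; exists z.
  pose z0 : T := fun i => sval (nu i).
  have z0P i z : A z -> z i <> z0 i by move=> Az; exact: (svalP (nu i) z Az).
  apply: (maxA (A `|` [set z0])).
    split; first by move=> z Az; left.
    move=> /(_ z0) sub; have Az0 : A z0 by apply: sub; right.
    exact: (z0P i0 z0 Az0).
  move=> i z w [Az|->] [Aw|->] e //; first exact: (PA i).
    by case: (z0P i z Az).
  by case: (z0P i w Aw); rewrite -e.
exists i => j; apply: (@card_leT_inj _ _ (fun u => sval (cid (hi u)) j)) => u v.
have [Au eu] := svalP (cid (hi u)); have [Av ev] := svalP (cid (hi v)).
by move=> /(PA j _ _ Au Av) e; rewrite -eu -ev e.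
Qed.

Lemma card_minP (P : set Card) : P !=set0 -> is_least P (card_min P).
Proof.
move=> [k0 Pk0]; rewrite /card_min; case: pselect => [h|[]].
  exact: svalP (cid h).
have [[k Pk] kmin] :=
  @least_inj {k | P k} (fun k => sval k) (exist _ k0 Pk0).
by exists k; split => // l Pl; exact: (kmin (exist _ l Pl)).
Qed.

Lemma ole_refl (o : Ord) (x : o) : ole x x.
Proof.
case: (@ole_wo o [pred z | `[< z = x >]]) => [|z [[/asboolP -> H] _]].
  by exists x; exact/asboolP.
by apply: H; exact/asboolP.
Qed.

Lemma ole_anti (o : Ord) (x y : o) : ole x y -> ole y x -> x = y.
Proof.
move=> xy yx.
have [|z [_ zu]] := @ole_wo o [pred z | `[< z = x \/ z = y >]].
  by exists x; apply/asboolP; left.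
have zx : z = x.
  apply: zu; split; first by apply/asboolP; left.
  by move=> w /asboolP[] ->; rewrite ?ole_refl.
have zy : z = y.
  apply: zu; split; first by apply/asboolP; right.
  by move=> w /asboolP[] ->; rewrite ?ole_refl.
by rewrite -zx -zy.
Qed.

Lemma card_sig T (A : set T) : [set: {x | A x}] #= A.
Proof.
rewrite -(card_eqr (card_setT A)); apply/card_eqPle; split.
  apply: (@card_leT_inj _ _ (fun x : {x | A x} =>
    exist (fun y => y \in A) (sval x) (mem_set (svalP x)))) => -[x Ax] [y Ay] [e].
  exact: eq_exist.
apply: (@card_leT_inj _ _ (fun x : set_type A =>
  exist A (sval x) (set_mem (svalP x)))) => -[x Ax] [y Ay] [e].
exact: eq_exist.
Qed.

Definition seg_le (o : Ord) (a : o) : rel {y : o | olt y a} :=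
  fun x y => ole (sval x) (sval y).

Lemma seg_wo (o : Ord) (a : o) : well_order (@seg_le o a).
Proof.
apply: antisymmetric_well_order => [[x xa] [y ya] /andP[xy yx]|A [x Ax]].
  by apply: eq_exist; exact: ole_anti.
have [|_ [[/asboolP[y Ay <-] ymin] _]] :=
    @ole_wo o [pred z | `[< exists2 y, y \in A & sval y = z >]].
  by exists (sval x); apply/asboolP; exists x.
by exists y; split => // z Az; apply: ymin; apply/asboolP; exists z.
Qed.

Lemma card_exists (T : Type) : exists k : Card, [set: T] #= [set: k].
Proof.
have [R Rwo] := well_ordering_principle {classic T}.
pose o := @MkOrd T R Rwo; rewrite -[T]/(ord_car o); move: o => o {R Rwo}.
have [[x ox]|no] :=
    pselect (exists x : o, [set: o] #<= [set y : o | olt y x]); last first.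
  unshelve eexists (@MkCard o _); last exact: card_eqxx.
  by move=> x ox; apply: no; exists x.
have [|a [[/asboolP oa amin] _]] :=
    @ole_wo o [pred x : o | `[< [set: o] #<= [set y | olt y x] : Prop >]].
  by exists x; exact/asboolP.
pose S : Ord := MkOrd (@seg_wo o a).
have oS : [set: o] #<= [set: S].
  by rewrite (card_le_eqr (card_sig [set y | olt y a])).
unshelve eexists (@MkCard S _).
  move=> [x' [xa ne]] H; apply/ne/ole_anti => //; apply: amin; apply/asboolP.
  apply: card_le_trans oS (card_le_trans H _).
  set B := [set y | _]; have im : sval @` B #= B.
    by apply: inj_card_eq => -[u hu] [v hv] _ _ /= e; exact: eq_exist.
  rewrite -(card_le_eql im); apply: subset_card_le => _ [[u hu] [/= le ne'] <-].
  by split => // e; apply: ne'; exact: eq_exist.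
apply/card_eqPle; split => //.
apply: (@card_leT_inj _ _ (fun y : S => sval y)) => -[u hu] [v hv] /= e.
exact: eq_exist.
Qed.

Definition card_sup (P : set Card) : Card :=
  card_min [set k | forall l, P l -> cle l k].

Lemma card_supP T (P : set Card) :
  (forall k, P k -> [set: k] #<= [set: T]) ->
  is_least [set k | forall l, P l -> cle l k] (card_sup P).
Proof.
move=> PT; apply: card_minP; have [k Tk] := card_exists T.
by exists k => l Pl; rewrite /cle -(card_le_eqr Tk); exact: PT.
Qed.

Definition attained (P : set Card) : Prop :=
  exists k, P k /\ forall l, P l -> ~ clt k l.

Definition cofinal_in T (R : T -> T -> Prop) (C D : set T) : Prop :=
  D `<=` C /\ forall x, C x -> exists2 y, D y & R x y.

(* [R] is meant to be the reflexive version of the order (see [cfP]). *)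
Definition cf T (R : T -> T -> Prop) (C : set T) : Card :=
  card_min [set k : Card | exists D, cofinal_in R C D /\ D #= [set: k]].

Lemma cfP T (R : T -> T -> Prop) (C : set T) : (forall x, C x -> R x x) ->
  is_least [set k : Card | exists D, cofinal_in R C D /\ D #= [set: k]] (cf R C).
Proof.
move=> Rxx; apply: card_minP; have [k Ck] := card_exists {x | C x}.
exists k, C; split; first by split => // x Cx; exists x => //; apply: Rxx.
by rewrite -(card_eql (card_sig C)).
Qed.

Definition ocf (o : Ord) : Card := cf (fun x y : o => ole x y) [set: o].

Definition regular (k : Card) : Prop :=
  infinite_set [set: k] /\ ceq (ocf k) k.

Definition regular_uncountable (k : Card) : Prop :=
  regular k /\ ~ countable [set: k].

Definition Reg : set Card := [set k | regular k].

(* Closedness: [C] contains every nonzero limit [d] below which it is unbounded. *)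
Definition club (o : Ord) (C : set o) : Prop :=
  (forall x, exists2 y, C y & ole x y) /\
  (forall d : o, (exists x, olt x d) ->
     (forall x, olt x d -> exists y, [/\ C y, olt x y & olt y d]) -> C d).

Definition stationary (o : Ord) (S : set o) : Prop :=
  forall C : set o, club C -> S `&` C !=set0.

Definition les (f g : nat -> nat) : Prop :=
  finite_set [set n | ~ (f n <= g n)%N].

Definition les_bounded (B : set (nat -> nat)) : Prop :=
  exists g, forall f, B f -> les f g.

Definition les_chain (C : set (nat -> nat)) : Prop :=
  forall f g, C f -> C g -> les f g \/ les g f.

Definition has_les_chain (o : Ord) : Prop :=
  exists f : o -> nat -> nat, forall x y, olt x y ->
    les (f x) (f y) /\ ~ les (f y) (f x).

Definition S_up : set Card :=
  [set k | exists C : set (nat -> nat),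
     [/\ les_chain C, ~ les_bounded C & ceq k (cf les C)]].

Definition S_h : set Card :=
  [set k | exists X : set (nat -> nat), X #= [set: k] /\
     forall B, B `<=` X -> (les_bounded B <-> ~ (X #<= B))].

Definition b_up : Card := card_sup S_up.
Definition b_h : Card := card_sup S_h.

(* Well-founded countably branching trees, representing the hereditarily
   countable sets: [HCset D f] is the set whose elements are the [f n] for [n]
   in [D].  Distinct trees may represent the same set; [hc_eq] is extensional
   equality. *)
Inductive HC := HCset (D : set nat) (f : forall n, D n -> HC).

Fixpoint hc_eq (x y : HC) : Prop :=
  let: HCset D f := x in
  let: HCset E g := y in
  (forall n (Dn : D n), exists m (Em : E m), hc_eq (f n Dn) (g m Em)) /\
  (forall m (Em : E m), exists n (Dn : D n), hc_eq (f n Dn) (g m Em)).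

Definition hc_in (x y : HC) : Prop :=
  let: HCset E g := y in exists m (Em : E m), hc_eq x (g m Em).

(* Formulas of the language of set theory, with de Bruijn indices. *)
Inductive form :=
| FIn (i j : nat)
| FEq (i j : nat)
| FNot (p : form)
| FAnd (p q : form)
| FAll (p : form).

Fixpoint sat (e : nat -> HC) (p : form) : Prop :=
  match p with
  | FIn i j => hc_in (e i) (e j)
  | FEq i j => hc_eq (e i) (e j)
  | FNot q => ~ sat e q
  | FAnd q r => sat e q /\ sat e r
  | FAll q => forall x, sat (fun n => if n is m.+1 then e m else x) q
  end.

(* The free variable 0 stands for the element and the free variable 1 for the
   parameter (larger free variables are also read as the parameter). *)
Definition definable (A : set HC) : Prop :=
  exists (p : form) (a : HC), forall x,
    A x <-> sat (fun n => if n is 0 then x else a) p.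

Definition hc_upair (x y : HC) : HC :=
  @HCset setT (fun n _ => if n is 0 then x else y).

Definition hc_pair (x y : HC) : HC := hc_upair (hc_upair x x) (hc_upair x y).

Definition hc_empty : HC := @HCset set0 (fun _ => False_rect HC).

Definition hc_succ (x : HC) : HC :=
  let: HCset D f := x in
  @HCset (fun n => if n is m.+1 then D m else True)
    (fun n => match n with 0 => fun _ => x | m.+1 => f m end).

(* The von Neumann natural numbers. *)
Definition hc_nat (n : nat) : HC := iter n hc_succ hc_empty.

Definition hc_subset (x : set nat) : HC := @HCset x (fun n _ => hc_nat n).

Definition hc_fun (f : nat -> nat) : HC :=
  @HCset setT (fun n _ => hc_pair (hc_nat n) (hc_nat (f n))).

(* A finite sequence is a function whose domain is a natural number. *)
Definition hc_tuple (s : seq (set nat)) : HC :=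
  @HCset `I_(size s) (fun n _ =>
    hc_pair (hc_nat n) (hc_subset (nth set0 s n))).

Definition definable_tuples (A : set (seq (set nat))) : Prop :=
  definable [set x | exists2 s, A s & hc_eq x (hc_tuple s)].

Definition definable_relation (R : set HC) : Prop :=
  definable R /\ forall z, R z -> exists x y, hc_eq z (hc_pair x y).

Definition rel_on_reals (R : set HC) (f g : nat -> nat) : Prop :=
  R (hc_pair (hc_fun f) (hc_fun g)).

(* Well-orders are strict here.  Allowing reflexive ones in [DO] below would not
   change it, since [R] minus (or plus) equality is definable if [R] is. *)
Definition well_orders T (R : T -> T -> Prop) (X : set T) : Prop :=
  [/\ forall x, X x -> ~ R x x,
      forall x y z, X x -> X y -> X z -> R x y -> R y z -> R x z,
      forall x y, X x -> X y -> [\/ R x y, x = y | R y x] &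
      forall Y, Y `<=` X -> Y !=set0 ->
        exists2 y, Y y & forall z, Y z -> z <> y -> R y z].

Definition is_otp T (R : T -> T -> Prop) (X : set T) (o : Ord) : Prop :=
  exists h : o -> T, range h = X /\
    forall x y : o, olt x y <-> R (h x) (h y).

Definition DO : set Card :=
  [set k | exists (X : set (nat -> nat)) (R : set HC) (o : Ord),
     [/\ definable_relation R, well_orders (rel_on_reals R) X,
         is_otp (rel_on_reals R) X o & ceq k (ocf o)]].

Definition do_sup : Card := card_sup DO.

Definition HP (k : Card) : Prop :=
  forall (f : k -> set nat) (A : set (seq (set nat))),
    (forall s, A s -> uniq s) -> definable_tuples A ->
    (exists S : set k, stationary S /\
       forall s, s <> [::] -> uniq s ->
         (forall x, x \in s -> (f @` S) x) -> A s) \/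
    (exists n : nat, (0 < n)%N /\ exists S : 'I_n -> set k,
       (forall i, stationary (S i)) /\
       forall s : n.-tuple (set nat), uniq s ->
         (forall i, (f @` S i) (tnth s i)) -> ~ A s).

Definition matrix_meet K (a : K -> nat -> set nat) (t : seq nat)
    (al : 'I_(size t) -> K) : set nat :=
  \bigcap_(n : 'I_(size t)) a (al n) (nth 0%N t n).

Definition Cs (k : Card) : Prop :=
  forall (a : k -> nat -> set nat) (T : set (seq nat)),
    (exists S : set k, stationary S /\
       forall t, T t -> forall al : 'I_(size t) -> k, injective al ->
         (forall i, S (al i)) -> matrix_meet a al <> set0) \/
    (exists t, T t /\ exists S : 'I_(size t) -> set k,
       (forall i, stationary (S i)) /\
       forall al : 'I_(size t) -> k, injective al ->
         (forall i, S i (al i)) -> matrix_meet a al = set0).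

Definition Cs_hat (k : Card) : Prop :=
  forall (a : k -> nat -> set nat) (T : set (seq nat)),
    (exists S : set k, stationary S /\
       forall t, T t -> forall al : 'I_(size t) -> k, injective al ->
         (forall i, S (al i)) -> finite_set (matrix_meet a al)) \/
    (exists t, T t /\ exists S : 'I_(size t) -> set k,
       (forall i, stationary (S i)) /\
       forall al : 'I_(size t) -> k, injective al ->
         (forall i, S i (al i)) -> infinite_set (matrix_meet a al)).

(* Main.v *)
Require Import Defs.
From mathcomp Require Import all_boot.
From mathcomp Require Import boolp classical_sets functions cardinality wochoice.

Set Implicit Arguments.
Unset Strict Implicit.
Unset Printing Implicit Defensive.

Local Open Scope classical_set_scope.
Local Open Scope card_scope.

(** Two mechanisms refute the principles.

    For the matrix principles, suppose that f and g are k-sequences of functions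
    such that f_x is eventually dominated by g_y for x < y, but f_y is not
    eventually dominated by g_x.  Let column 2n of row x be the part of the
    plane above the graph of g_x to the right of n, and column 2n + 1 the part
    below the graph of f_x to the right of n.  Column 2n of row x meets column
    2n + 1 of row y in the region between g_x and f_y: it is infinite if x < y,
    while if y < x it is finite, and empty as soon as n is large.  Stationary
    sets are unbounded, so within one of them, and across any two of them, rows
    occur in both orders.  This refutes both alternatives of both principles
    ([interleaved_scales_refute]).

    Such sequences come from a chain C of cofinality at least k: never
    being cofinal in C before stage k, an increasing sequence can be continued
    all the way, and f = g works ([has_les_chain_of_cf]).  They also come from a
    family X, of size a cardinal of cofinality at least k, whose bounded
    subsets are exactly those of smaller size ([S_h_refutes]): choose g_x above
    all earlier f_y, which form a bounded set, and f_x in X not dominated by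
    any earlier g_y.  Such an f_x exists because the earlier g_y account for
    fewer than k subsets of X of smaller size; that these do not cover X is
    where cofinality, and the equality of an infinite cardinal with its square,
    enter ([cf_not_covered_by_small]).

    For the homogeneity principle, let R be definable and well-order a set of
    reals in a type of cofinality at least k.  Code a strictly R-increasing
    k-sequence of reals by subsets of nat, and let A consist of the finite
    sequences of distinct codes along which R increases.  A stationary set
    contains a pair in decreasing order, and an increasing tuple can be chosen
    across finitely many stationary sets, so both alternatives fail
    ([DO_refutes]).  The work lies in writing A as a formula
    ([definable_increasing_tuples]).

    Everywhere the hypothesis is only that k is at most the relevant
    cofinality, so the same lemmas show that every member of the set of
    cardinals in question lies strictly below k when the principle holds at k;
    hence the supremum is at most k, and less than k if it is attained
    ([card_sup_bounds]).  For families X, where size and cofinality may differ,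
    this applies to members that are regular. *)

(** * Well-ordered types *)

Lemma ole_min (o : Ord) (P : set o) :
  P !=set0 -> exists2 x, P x & forall y, P y -> ole x y.
Proof.
move=> [x Px]; have [|m [[/asboolP Pm minm] _]] := @ole_wo o [pred z | `[< P z >]].
  by exists x; exact/asboolP.
by exists m => // y Py; apply: minm; exact/asboolP.
Qed.

Lemma ole_total (o : Ord) (x y : o) : ole x y \/ ole y x.
Proof.
have [|z [->|->] zmin] := @ole_min o [set x; y]; first by exists x; left.
  by left; apply: zmin; right.
by right; apply: zmin; left.
Qed.

Lemma ole_trans (o : Ord) (y x z : o) : ole x y -> ole y z -> ole x z.
Proof.
move=> xy yz.
have [|w [->|[->|->]] wmin] := @ole_min o [set w | w = x \/ w = y \/ w = z].
- by exists x; left.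
- by apply: wmin; right; right.
- have yx : ole y x by apply: wmin; left.
  by rewrite (ole_anti xy yx).
- have zy : ole z y by apply: wmin; right; left.
  by rewrite -(ole_anti yz zy).
Qed.

Lemma ole_eqVlt (o : Ord) (x y : o) : ole x y -> x = y \/ olt x y.
Proof. by move=> xy; have [->|ne] := pselect (x = y); [left|right]. Qed.

Lemma oltNge (o : Ord) (x y : o) : olt x y <-> ~ ole y x.
Proof.
split=> [[xy ne] yx|nyx]; first exact/ne/ole_anti.
have [xy|//] := ole_total x y; split=> // e.
by apply: nyx; rewrite e; exact: ole_refl.
Qed.

Lemma olt_le_trans (o : Ord) (y x z : o) : olt x y -> ole y z -> olt x z.
Proof.
move=> /oltNge nyx yz; apply/oltNge => zx; exact/nyx/(ole_trans yz zx).
Qed.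

Lemma ole_lt_trans (o : Ord) (y x z : o) : ole x y -> olt y z -> olt x z.
Proof.
move=> xy /oltNge nzy; apply/oltNge => zx; exact/nzy/(ole_trans zx xy).
Qed.

Lemma olt_trans (o : Ord) (y x z : o) : olt x y -> olt y z -> olt x z.
Proof. by move=> xy [yz _]; exact: olt_le_trans xy yz. Qed.

Lemma olt_neq_total (o : Ord) (x y : o) : x <> y -> olt x y \/ olt y x.
Proof.
by move=> ne; have [xy|yx] := ole_total x y; [left|right]; split => // /esym.
Qed.

Lemma omax (o : Ord) (x y : o) : exists2 z, ole x z & ole y z.
Proof.
have [xy|yx] := ole_total x y; first by exists y => //; exact: ole_refl.
by exists x => //; exact: ole_refl.
Qed.

Lemma olt_wf (o : Ord) : well_founded (@olt o).
Proof.
move=> x; apply: contrapT => nx.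
have [|m nm minm] := @ole_min o [set z | ~ Acc (@olt o) z]; first by exists x.
apply: nm; constructor => y /oltNge ym.
by apply: contrapT => ny; apply: ym; exact: minm.
Qed.

(** Dependent choice along a well-order: it packages the recursions below, in
    which the value at [x] only has to satisfy a condition on the earlier
    values, and exists only if those were themselves well chosen. *)
Lemma transfinite_choice (o : Ord) (T : Type) (t0 : T)
    (P : o -> (o -> T) -> T -> Prop) :
  (forall x F, (forall y, olt y x -> P y F (F y)) -> exists t, P x F t) ->
  (forall x F G t, (forall y, olt y x -> F y = G y) -> P x F t -> P x G t) ->
  exists F, forall x, P x F (F x).
Proof.
move=> Pex Pext.
(* [P x] only looks below [x], so the default value [t0] beyond is harmless. *)
pose extend (x : o) (r : forall y : o, olt y x -> T) (y : o) :=
  if pselect (olt y x) is left h then r y h else t0.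
pose step (x : o) (r : forall y : o, olt y x -> T) :=
  if pselect (exists t, P x (extend x r) t) is left h then sval (cid h) else t0.
pose F := Fix (@olt_wf o) (fun _ => T) step.
have FE x : F x = step x (fun y _ => F y).
  rewrite /F Fix_eq // => z f g fg; congr step.
  by by apply: functional_extensionality_dep => y; apply/funext => h; exact: fg.
exists F; apply: (well_founded_ind (@olt_wf o)) => x IH.
have ext y : olt y x -> extend x (fun y _ => F y) y = F y.
  by rewrite /extend; case: pselect.
rewrite FE /step; case: pselect => [h|nh].
  exact: Pext ext (svalP (cid h)).
have [t Pt] := Pex x F IH; case: nh; exists t; apply: Pext Pt => y yx.
by rewrite ext.
Qed.

(** * Cardinalities *)

Lemma card_le_of_inj T U (A : set T) (B : set U) (f : T -> U) :
  (forall x, A x -> B (f x)) ->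
  (forall x y, A x -> A y -> f x = f y -> x = y) -> A #<= B.
Proof.
move=> fAB finj; have [g] : $|{injfun A >-> B}|.
  apply/injfunPex; exists f => // x y /set_mem Ax /set_mem Ay; exact: finj.
exact: inj_card_le g.
Qed.

Lemma card_le_fun T U (u0 : U) (A : set T) (B : set U) : A #<= B ->
  exists f : T -> U, (forall x, A x -> B (f x)) /\
    forall x y, A x -> A y -> f x = f y -> x = y.
Proof.
move=> /card_leP[h].
pose f x := if pselect (A x) is left Ax then
  sval (h (exist (fun z => z \in A) x (mem_set Ax))) else u0.
exists f; split=> [x Ax|x y Ax Ay]; rewrite /f; case: pselect => // Ax'.
  by apply: set_mem; exact: svalP (h _).
case: pselect => // Ay' /eq_sig_hprop e.
have {}e := e (fun z p q => bool_irrelevance p q).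
by have [] := @inj _ _ _ h _ _ (mem_set I) (mem_set I) e.
Qed.

Lemma card_leX T U V W (A : set T) (B : set U) (C : set V) (D : set W) :
  A #<= C -> B #<= D -> A `*` B #<= C `*` D.
Proof.
have [->|/set0P[c0 Cc0]] := eqVneq C set0.
  by rewrite card_le0 => /eqP->; rewrite set0X card_ge0.
have [->|/set0P[d0 Dd0]] := eqVneq D set0.
  by move=> _; rewrite card_le0 => /eqP->; rewrite setX0 card_ge0.
move=> /(card_le_fun c0)[f [fAC finj]] /(card_le_fun d0)[g [gBD ginj]].
apply: (@card_le_of_inj _ _ _ _ (fun p => (f p.1, g p.2))) => [[a b] [/= Aa Bb]|].
  by split; [exact: fAC|exact: gBD].
move=> [a b] [a' b'] [/= Aa Bb] [/= Aa' Bb'] [ea eb].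
by rewrite (finj _ _ Aa Aa' ea) (ginj _ _ Bb Bb' eb).
Qed.

(** Comparability comes from the existence of a least member in a family of
    cardinalities, here a family of two. *)
Lemma card_le_total T U (A : set T) (B : set U) : A #<= B \/ B #<= A.
Proof.
have [b H] := @least_inj bool (fun b => if b then {x | A x} else {x | B x}) true.
by case: b H => H; [left; have := H false|right; have := H true];
  rewrite (card_le_eql (Defs.card_sig _)) (card_le_eqr (Defs.card_sig _)).
Qed.

(** If no proper initial segment of a well-order can absorb [A], then choosing
    greedily a fresh element of [A] at each stage never gets stuck. *)
Lemma card_le_segments (o : Ord) U (A : set U) :
  (forall x : o, ~ (A #<= [set y | olt y x])) -> [set: o] #<= A.
Proof.
move=> nA; have [[x0]|no] := pselect (inhabited o); last first.
  have -> : [set: o] = set0 by apply/seteqP; split => // x; case: no.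
  exact: card_ge0.
have /set0P[u0 _] : A != set0.
  by apply/eqP => A0; apply: (nA x0); rewrite A0 card_ge0.
have [|x F G t e [At fresh]|F FP] := @transfinite_choice o U u0
    (fun x F t => A t /\ forall y, olt y x -> F y <> t).
- move=> x F _; apply: contrapT => nt; apply: (nA x).
  apply: card_le_trans (card_image_le F _).
  apply: subset_card_le => u Au; apply: contrapT => nu; apply: nt; exists u.
  by split=> // y yx e; apply: nu; exists y.
- by split=> // y yx; rewrite -e //; exact: fresh.
apply: (@card_le_of_inj _ _ _ _ F) => [x _|x y _ _ e]; first exact: (FP x).1.
apply: contrapT => /olt_neq_total[xy|yx].
- exact: (FP y).2 xy e.
- exact: (FP x).2 yx (esym e).
Qed.

(** Hilbert's hotel: move [x] to the first term of an infinite sequence avoiding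
    [x], and each term to the next one. *)
Lemma infinite_card_le_setD1 T (A : set T) (x : T) :
  infinite_set A -> A #<= A `\ x.
Proof.
move=> /infinite_setD/(_ (finite_set1 x))/infiniteP/(card_le_fun x)[g [gA ginj]].
have {}ginj m n : g m = g n -> m = n by exact: ginj.
have {}gA n : A (g n) /\ g n <> x by exact: gA.
pose h y := if pselect (y = x) is left _ then g 0 else
  if pselect (exists n, g n = y) is left e then g (sval (cid e)).+1 else y.
have hx : h x = g 0 by rewrite /h; case: pselect.
have hg n : h (g n) = g n.+1.
  rewrite /h; case: pselect => [/(gA n).2 //|_]; case: pselect => [e|[]].
    by rewrite (ginj _ _ (svalP (cid e))).
  by exists n.
have hn y : y <> x -> (forall n, g n <> y) -> h y = y.
  rewrite /h; case: pselect => // _ _ ny; case: pselect => // -[n] /ny[].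
have cases y : y = x \/ (exists n, y = g n) \/ (y <> x /\ forall n, g n <> y).
  have [->|ne] := pselect (y = x); first by left.
  have [[n <-]|nn] := pselect (exists n, g n = y); right; [left|right].
    by exists n.
  by split=> // n e; apply: nn; exists n.
apply: (@card_le_of_inj _ _ _ _ h) => [y Ay|y z _ _].
  have [->|[[n ->]|[ne nn]]] := cases y; rewrite ?hx ?hg ?(hn _ ne nn) //;
    exact: gA.
have [->|[[n ->]|[ne nn]]] := cases y; have [->|[[m ->]|[me mn]]] := cases z;
  rewrite ?hx ?hg ?(hn _ ne nn) ?(hn _ me mn) // => e.
- by have := ginj _ _ e.
- by case: (mn 0).
- by have := ginj _ _ e.
- by have [->] := ginj _ _ e.
- by case: (mn n.+1).
- by case: (nn 0).
- by case: (nn m.+1).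
Qed.

Lemma infinite_card_no_max (k : Card) (x : k) :
  infinite_set [set: k] -> exists y, olt x y.
Proof.
move=> kinf; apply: contrapT => nx; apply: (@card_initial k x).
apply: card_le_trans (infinite_card_le_setD1 x kinf) _.
apply: subset_card_le => y [_ ne]; apply/oltNge => xy.
have [e|lt] := ole_eqVlt xy; first by case: ne.
by apply: nx; exists y.
Qed.

Lemma card_no_max2 (k : Card) (x y : k) :
  infinite_set [set: k] -> exists z, olt x z /\ olt y z.
Proof.
move=> kinf; have [m xm ym] := omax x y.
have [z mz] := infinite_card_no_max m kinf.
by exists z; split; [exact: ole_lt_trans xm mz|exact: ole_lt_trans ym mz].
Qed.

(** Compare values of [h] first, and break ties by an arbitrary well-order. *)
Lemma well_order_along (o : Ord) T (h : T -> o) :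
  exists R : rel T, well_order R /\ forall p q, R p q -> ole (h p) (h q).
Proof.
have [V Vwo] := well_ordering_principle {classic T}.
pose v := @MkOrd T V Vwo.
pose R : rel T := fun p q => `[< olt (h p) (h q) \/ h p = h q /\ @ole v p q >].
exists R; split=> [|p q /asboolP[[]//|[-> _]]]; last exact: ole_refl.
apply: antisymmetric_well_order => [p q /andP[/asboolP pq /asboolP qp]|A [p Ap]].
  case: pq qp => [pq|[e pq]] [qp|[e' qp]].
  - by have [_ []] := olt_trans pq qp.
  - by move: pq; rewrite e' => -[_ []].
  - by move: qp; rewrite e => -[_ []].
  - exact: (@ole_anti v).
have [|m [q Aq hq] mmin] := @ole_min o [set m | exists2 q, q \in A & h q = m].
  by exists (h p), p.
have [|z [Az hz] zmin] := @ole_min v [set z | z \in A /\ h z = m].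
  by exists q.
exists z; split=> // w Aw; apply/asboolP.
have [|e|] := @ole_eqVlt _ m (h w); first by apply: mmin; exists w.
  by right; split; [rewrite hz|exact: zmin].
by left; rewrite hz.
Qed.

(** Goedel's argument: in a least counterexample, order pairs by their maximum;
    then every initial segment of the square lies in the square of a proper
    initial segment of the cardinal, which is too small to absorb the latter. *)
Lemma infinite_card_square (k : Card) :
  infinite_set [set: k] -> [set: k * k] #<= [set: k].
Proof.
move=> kinf; apply: contrapT => kP.
have : [set k : Card | infinite_set [set: k] /\ ~ ([set: k * k] #<= [set: k])] !=set0.
  by exists k.
move=> /card_minP; set l := card_min _ => -[[linf lP] lmin].
have seg_small (s : l) : ~ ([set: l] #<= [set y | olt y s] `*` [set y | olt y s]).
  have [sfin|sinf] := pselect (finite_set [set y | olt y s]) => le.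
    by apply: linf; apply: card_le_finite le (finite_setX sfin sfin).
  have [c cs] := card_exists {y | olt y s}.
  have {}cs : [set y | olt y s] #= [set: c] by rewrite -(card_eql (Defs.card_sig _)).
  apply: (@card_initial l s); rewrite (card_le_eqr cs).
  apply: card_le_trans le _; apply: contrapT => nc.
  have : cle l c.
    apply: lmin; split=> [cfin|ccc].
      by apply: sinf; move: cfin; rewrite -(eq_finite_set cs).
    apply: nc; apply: card_le_trans ccc.
    by rewrite -setXTT; apply: card_leX; rewrite (card_le_eql cs).
  by rewrite /cle -(card_le_eqr cs); exact: card_initial.
have max (p : l * l) : exists m, ole p.1 m /\ ole p.2 m.
  by have [m] := omax p.1 p.2; exists m.
have [R [Rwo Rmax]] := well_order_along (fun p => sval (cid (max p))).
apply: lP; apply: (@card_le_segments (MkOrd Rwo)) => q.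
have [s qs] := infinite_card_no_max (sval (cid (max q))) linf.
move=> le; apply: (seg_small s); apply: card_le_trans le _.
apply: subset_card_le => -[a b] [/Rmax /= mab _].
have [/= am bm] := svalP (cid (max (a, b))).
by split; apply: ole_lt_trans qs; [exact: ole_trans am mab|exact: ole_trans bm mab].
Qed.

Lemma not_card_le_segX (k : Card) (s t : k) : infinite_set [set: k] ->
  ~ ([set: k] #<= [set y | olt y s] `*` [set y | olt y t]).
Proof.
move=> kinf le; have [m sm tm] := omax s t.
set A := [set y | olt y m].
have {}le : [set: k] #<= A `*` A.
  apply: card_le_trans le _; apply: card_leX; apply: subset_card_le => y /= yl.
    exact: olt_le_trans yl sm.
  exact: olt_le_trans yl tm.
have [Afin|Ainf] := pselect (finite_set A).
  by apply: kinf; apply: card_le_finite le (finite_setX Afin Afin).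
have [c cA] := card_exists {y | A y}.
have {}cA : A #= [set: c] by rewrite -(card_eql (Defs.card_sig _)).
apply: (@card_initial k m); rewrite -/A (card_le_eqr cA).
apply: card_le_trans le _; apply: card_le_trans (infinite_card_square _).
  by rewrite -setXTT; apply: card_leX; rewrite (card_le_eql cA).
by rewrite -(eq_finite_set cA).
Qed.

(** * Cofinality *)

Lemma not_cofinal (k : Card) T (R : T -> T -> Prop) (C D : set T) (x : k) :
  (forall c, C c -> R c c) -> cle k (cf R C) ->
  D `<=` C -> D #<= [set y | olt y x] ->
  exists2 c, C c & forall d, D d -> ~ R c d.
Proof.
move=> Rxx kC DC Dx; apply: contrapT => ncof.
have [d Dd] := card_exists {u | D u}.
have {}Dd : D #= [set: d] by rewrite -(card_eql (Defs.card_sig _)).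
have : cle (cf R C) d.
  apply: (cfP Rxx).2; exists D; split=> //; split=> // c Cc.
  apply: contrapT => nd; apply: ncof; exists c => // e De Rce.
  by apply: nd; exists e.
move=> Cd; apply: (@card_initial k x); apply: card_le_trans kC _.
by apply: card_le_trans Cd _; rewrite -(card_le_eql Dd).
Qed.

Lemma cf_le (T : Type) (R : T -> T -> Prop) (C : set T) :
  (forall c, C c -> R c c) -> [set: cf R C] #<= C.
Proof.
move=> Rxx; have [d Cd] := card_exists {u | C u}.
have {}Cd : C #= [set: d] by rewrite -(card_eql (Defs.card_sig _)).
rewrite (card_le_eqr Cd); apply: (cfP Rxx).2; exists C; split=> //.
by split=> // c Cc; exists c => //; exact: Rxx.
Qed.

(** A sequence shorter than the cofinality is never cofinal, so it can always
    be continued by an element above all its terms. *)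
Lemma cf_sequence (k : Card) T (R : T -> T -> Prop) (C : set T) :
  (forall c, C c -> R c c) -> cle k (cf R C) -> inhabited k ->
  exists F : k -> T, forall x, C (F x) /\ forall y, olt y x -> ~ R (F x) (F y).
Proof.
move=> Rxx kC [x0].
have [t0 _ _] := @not_cofinal k T R C set0 x0 Rxx kC (@sub0set _ _) (card_ge0 _ _).
apply: (@transfinite_choice k T t0
  (fun x F t => C t /\ forall y, olt y x -> ~ R t (F y))) => [x F HF|x F G t e].
  have [||c Cc nc] := @not_cofinal k T R C (F @` [set y | olt y x]) x Rxx kC.
  - by move=> _ [y /HF[Cy _] <-].
  - exact: card_image_le.
  - by exists c; split=> // y yx; apply: nc; exists y.
by move=> [Ct nt]; split=> // y yx; rewrite -e //; exact: nt.
Qed.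

(** The consequence of [k <= cf |X|] that matters below, in a form that mentions
    no well-order of [X] and so passes to equipotent sets. *)
Definition not_covered_by_small (k : Card) U (X : set U) : Prop :=
  forall (x : k) (A : k -> set U),
    (forall y, olt y x -> A y `<=` X /\ ~ (X #<= A y)) ->
    exists2 u, X u & forall y, olt y x -> ~ A y u.

Lemma not_covered_by_small_card_eq (k : Card) U V (v0 : V)
    (X : set U) (Y : set V) : X #= Y ->
  not_covered_by_small k X -> not_covered_by_small k Y.
Proof.
move=> /card_eqPle[XY YX] HX x A HA.
have [j [jXY jinj]] := card_le_fun v0 XY.
have [|u Xu nu] := HX x (fun y => X `&` j @^-1` A y).
  move=> y yx; have [AY YA] := HA y yx; split=> [u []//|le]; apply: YA.
  apply: card_le_trans YX (card_le_trans le _).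
  by apply: (@card_le_of_inj _ _ _ _ j) => [u []|u v [Xu _] [Xv _]] //; exact: jinj.
by exists (j u); [exact: jXY|move=> y yx Au; apply: (nu y yx)].
Qed.

(** The small sets embed in proper initial segments of [l]; by cofinality these
    have a common bound, so the union embeds in a product of two initial
    segments. *)
Lemma cf_not_covered_by_small (k l : Card) :
  infinite_set [set: l] -> cle k l -> cle k (ocf l) ->
  not_covered_by_small k [set: l].
Proof.
move=> linf kl kcf x A HA.
have below B : ~ ([set: l] #<= B : Prop) -> exists z : l, B #<= [set y | olt y z].
  move=> nB; apply: contrapT => nz; apply/nB/card_le_segments => z Bz.
  by apply: nz; exists z.
have /choice[z zP] y : exists z : l, olt y x -> A y #<= [set w | olt w z].
  have [yx|nyx] := pselect (olt y x).
    by have [z] := below _ _ (HA y yx).2; exists z.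
  by have /set0P[z _] : [set: l] != set0; [exact/set0P/infinite_setN0|exists z].
have [||w _ wP] := @not_cofinal k l (fun x y => ole x y) setT
    (z @` [set y | olt y x]) x (fun c _ => ole_refl c) kcf.
- by [].
- exact: card_image_le.
have [s xs] : exists s : l, [set y | olt y x] #<= [set y | olt y s].
  have xk : ~ ([set: l] #<= [set y | olt y x]).
    by move=> /(card_le_trans kl); exact: card_initial.
  apply: contrapT => ns; apply/xk/card_le_segments => s le.
  by apply: ns; exists s.
(* Send [u] to an index [i u] of a set that contains it, paired with its image
   under the embedding of this set below the common bound [w]. *)
apply: contrapT => cov.
have /choice[i iP] u : exists y, olt y x /\ A y u.
  apply: contrapT => ny; apply: cov; exists u => // y yx Au.
  by apply: ny; exists y.
apply: (@not_card_le_segX l s w linf); apply: card_le_trans (card_leX xs (card_lexx _)).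
have /choice[g gP] y : exists g : l -> l, olt y x ->
    (forall u, A y u -> olt (g u) w) /\
    forall u v, A y u -> A y v -> g u = g v -> u = v.
  have [yx|nyx] := pselect (olt y x); last by exists id.
  have /(card_le_fun w)[g [gA ginj]] := zP y yx; exists g => _; split=> // u /gA gz.
  by apply: olt_le_trans gz _; have [//|wz] := ole_total (z y) w; case: (wP (z y));
    first exists y.
apply: (@card_le_of_inj _ _ _ _ (fun u => (i u, g (i u) u))) => [u _|u v _ _ [e]].
  by have [ix Ai] := iP u; split=> //=; exact: (gP _ ix).1.
have [ix Ai] := iP u; have [_ Av] := iP v; rewrite -e in Av *.
exact: (gP _ ix).2.
Qed.

(** * Stationary sets *)

Lemma stationary_unbounded (k : Card) (S : set k) (x : k) :
  infinite_set [set: k] -> stationary S -> exists2 y, S y & olt x y.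
Proof.
move=> kinf statS; have [|y [Sy xy]] := statS [set y | olt x y]; last by exists y.
split=> [z|d [z zd] Hd].
  by have [w [xw zw]] := card_no_max2 x z kinf; exists w => //; exact: zw.1.
by have [y [xy _ yd]] := Hd z zd; exact: olt_trans xy yd.
Qed.

(** * Two interleaved scales refute both matrix principles *)

Lemma les_refl f : les f f.
Proof.
rewrite /les; have -> : [set n | ~ (f n <= f n)%N] = set0.
  by apply/seteqP; split => // n /(_ (leqnn _)).
exact: finite_set0.
Qed.

Lemma les_from f g : les f g -> exists n, forall i, (n <= i)%N -> (f i <= g i)%N.
Proof.
rewrite /les => /finite_seqP[s sE].
exists (\max_(i <- s) i).+1 => i si; apply: contrapT => nle.
have : [set n | ~ (f n <= g n)%N] i by [].
rewrite sE /= => /(@leq_bigmax_seq _ _ xpredT id) /(_ isT).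
rewrite leqNgt => /negP; apply.
exact: si.
Qed.

(** Row [x] of the matrix codes, in column [2n], the region strictly above the
    graph of [g x] and, in column [2n + 1], the region below the graph of
    [f x], both cut off to the left of [n]. *)
Definition region_matrix (K : Type) (f g : K -> nat -> nat) (x : K) (m : nat) :
    set nat :=
  [set c | exists i v, [/\ c = pickle (i, v), (m./2 <= i)%N &
     if odd m then (v <= f x i)%N else (g x i < v)%N]].

Definition region_patterns : set (seq nat) :=
  [set t | exists n, t = [:: n.*2; n.*2.+1]].

Definition pair_fun (K : Type) (x y : K) (i : 'I_2) : K := if i == ord0 then x else y.

Lemma pair_fun_inj K (x y : K) : x <> y -> injective (pair_fun x y).
Proof.
move=> ne [[|[|//]] ?] [[|[|//]] ?] //= e; try exact: val_inj.
by case: ne.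
Qed.

Lemma pair_fun_in K (S : 'I_2 -> set K) (x y : K) :
  S ord0 x -> S ord_max y -> forall i, S i (pair_fun x y i).
Proof.
move=> S0x S1y [[|[|//]] lt]; rewrite /pair_fun /=.
  by rewrite (_ : Ordinal lt = ord0) //; exact: val_inj.
by rewrite (_ : Ordinal lt = ord_max) //; exact: val_inj.
Qed.

Lemma region_meetE K (f g : K -> nat -> nat) n (al : 'I_2 -> K) c :
  matrix_meet (t := [:: n.*2; n.*2.+1]) (region_matrix f g) al c <->
  exists i v, [/\ c = pickle (i, v), (n <= i)%N,
    (g (al ord0) i < v)%N & (v <= f (al ord_max) i)%N].
Proof.
split=> [H|[i [v [-> ni gv vf]]] [[|[|//]] lt] _ /=].
- have [i [v [cE ni]]] := H ord0 I; rewrite /= odd_double => gv.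
  have [i' [v' [cE' ni']]] := H ord_max I; rewrite /= odd_double /= => vf.
  have [? ?] : (i, v) = (i', v') by apply: (pcan_inj pickleK); rewrite -cE.
  by subst i' v'; exists i, v; split=> //; rewrite doubleK in ni.
- exists i, v; rewrite /= doubleK odd_double; split=> //.
  by rewrite (_ : Ordinal lt = ord0) //; exact: val_inj.
- exists i, v; rewrite /= uphalf_double odd_double; split=> //.
  by rewrite (_ : Ordinal lt = ord_max) //; exact: val_inj.
Qed.

Lemma region_meet_finite K (f g : K -> nat -> nat) n (al : 'I_2 -> K) :
  finite_set (matrix_meet (t := [:: n.*2; n.*2.+1]) (region_matrix f g) al) <->
  les (f (al ord_max)) (g (al ord0)).
Proof.
split=> fin.
  (* Where [f] exceeds [g], the highest point below the graph of [f] lies in the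
     meet; so these abscissae are projections of points of the meet. *)
  apply: sub_finite_set (_ : finite_set (`I_n `|`
    (fun c => (odflt (0, 0) (unpickle c)).1) @`
      matrix_meet (t := [:: n.*2; n.*2.+1]) (region_matrix f g) al)).
    move=> i /negP; rewrite -ltnNge => gf; have [ni|ni] := ltnP i n; first by left.
    right; exists (pickle (i, f (al ord_max) i)); last by rewrite pickleK.
    by apply/region_meetE; exists i, (f (al ord_max) i).
  by rewrite finite_setU; split; [exact: finite_II|exact: finite_image].
apply: sub_finite_set (bigcup_finite fin
  (F := fun i => (fun v => pickle (i, v)) @` `I_(f (al ord_max) i).+1) _).
  move=> c /region_meetE[i [v [-> ni gv vf]]]; exists i.
    by apply/negP; rewrite -ltnNge; exact: leq_trans gv vf.
  by exists v.
by move=> i _; apply: finite_image; exact: finite_II.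
Qed.

Lemma region_meet_eq0 K (f g : K -> nat -> nat) n (al : 'I_2 -> K) :
  matrix_meet (t := [:: n.*2; n.*2.+1]) (region_matrix f g) al = set0 <->
  forall i, (n <= i)%N -> (f (al ord_max) i <= g (al ord0) i)%N.
Proof.
split=> [meet0 i ni|le].
  rewrite leqNgt; apply/negP => gf.
  suff : set0 (pickle (i, f (al ord_max) i)) by [].
  by rewrite -meet0; apply/region_meetE; exists i, (f (al ord_max) i).
apply/seteqP; split=> // c /region_meetE[i [v [_ /le fg gv vf]]].
by have := leq_trans gv (leq_trans vf fg); rewrite ltnn.
Qed.

(** For [y < x] the meet of rows [x] and [y] is finite, and empty in a suitable
    pair of columns, as [f y] is eventually below [g x]; for [x < y] it is
    infinite in all of them.  Since stationary sets are unbounded, both orders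
    occur within one stationary set and across any two. *)
Lemma interleaved_scales_refute (k : Card) (f g : k -> nat -> nat) :
  infinite_set [set: k] ->
  (forall x y, olt x y -> les (f x) (g y) /\ ~ les (f y) (g x)) ->
  ~ Cs k /\ ~ Cs_hat k.
Proof.
move=> kinf fg; have /set0P[x0 _] : [set: k] != set0; first exact/set0P/infinite_setN0.
have pairs (S S' : set k) : stationary S -> stationary S' ->
    exists x y, [/\ S x, S' y & olt x y].
  move=> /(stationary_unbounded x0 kinf)[x Sx _].
  by move=> /(stationary_unbounded x kinf)[y S'y xy]; exists x, y.
split=> H; have [[S [statS HS]]|[t [[n ->]]]] := H (region_matrix f g) region_patterns.
- have [x [y [Sx Sy xy]]] := pairs S S statS statS.
  have [n fgn] := les_from (fg x y xy).1.
  have ne : y <> x by move=> e; move: xy; rewrite e => -[].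
  have patn : region_patterns [:: n.*2; n.*2.+1] by exists n.
  apply: (HS _ patn (pair_fun y x) (pair_fun_inj ne)).
    by move=> i; rewrite /pair_fun; case: ifP.
  exact/region_meet_eq0.
- move=> [S [statS HS]].
  have [x [y [Sx Sy xy]]] := pairs _ _ (statS ord0) (statS ord_max).
  have ne : x <> y by move=> e; move: xy; rewrite e => -[].
  apply: (fg x y xy).2; apply/(region_meet_finite f g n (pair_fun x y)).
  rewrite HS; [exact: finite_set0|exact: pair_fun_inj|].
  exact: (pair_fun_in (S := S)).
- have [x [y [Sx Sy xy]]] := pairs S S statS statS.
  have ne : x <> y by move=> e; move: xy; rewrite e => -[].
  have pat0 : region_patterns [:: 0.*2; 0.*2.+1] by exists 0.
  apply: (fg x y xy).2; apply/(region_meet_finite f g 0 (pair_fun x y)).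
  apply: (HS _ pat0 (pair_fun x y) (pair_fun_inj ne)).
  by move=> i; rewrite /pair_fun; case: ifP.
- move=> [S [statS HS]].
  have [y [x [Sy Sx yx]]] := pairs _ _ (statS ord_max) (statS ord0).
  have ne : x <> y by move=> e; move: yx; rewrite e => -[].
  apply: (HS (pair_fun x y) (pair_fun_inj ne)).
    exact: (pair_fun_in (S := S)).
  exact/(region_meet_finite f g n (pair_fun x y))/(fg y x yx).1.
Qed.

(** * Chains and unbounded families of functions *)

Lemma chain_refutes (k : Card) : infinite_set [set: k] -> has_les_chain k ->
  ~ Cs k /\ ~ Cs_hat k.
Proof.
by move=> kinf [f fP]; exact: (interleaved_scales_refute kinf (f := f) (g := f)).
Qed.

Lemma has_les_chain_of_cf (k : Card) (C : set (nat -> nat)) :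
  les_chain C -> inhabited k -> cle k (cf les C) -> has_les_chain k.
Proof.
move=> chainC k0 kC; have [F FP] := cf_sequence (fun f _ => les_refl f) kC k0.
exists F => x y xy; have nyx := (FP y).2 x xy; split=> //.
by have [] := chainC (F x) (F y) (FP x).1 (FP y).1.
Qed.

Lemma S_up_refutes (k l : Card) : infinite_set [set: k] ->
  S_up l -> cle k l -> ~ Cs k /\ ~ Cs_hat k.
Proof.
move=> kinf [C [chainC _ lC]] kl; apply: (chain_refutes kinf).
apply: (has_les_chain_of_cf chainC).
  by have [x _] := infinite_setN0 kinf; exists.
by rewrite /cle -(card_le_eqr lC).
Qed.

(** Along [k], pick [f x] in [X] outside of everything bounded by the earlier
    [g y], and [g x] above all the earlier [f y]: the former exists as [X] is
    not covered by fewer than [k] bounded subsets, the latter as [X] has no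
    unbounded subset of size less than [k].  The cardinal [m] lets the cofinality
    be computed in any initial ordinal of the size of [X], such as [b_h]. *)
Lemma S_h_refutes (k l m : Card) : infinite_set [set: k] -> S_h l -> ceq l m ->
  cle k m -> cle k (ocf m) -> ~ Cs k /\ ~ Cs_hat k.
Proof.
move=> kinf [X [Xl XP]] lm km kcf.
have Xm : X #= [set: m] by rewrite (card_eql Xl).
have minf : infinite_set [set: m] by move=> /(card_le_finite km).
have ncov : not_covered_by_small k X.
  apply: (@not_covered_by_small_card_eq k m _ id [set: m]).
    by rewrite card_eq_sym.
  exact: cf_not_covered_by_small.
have bounded x B : B `<=` X -> B #<= [set y : k | olt y x] -> les_bounded B.
  move=> BX Bx; apply/XP => // XB; apply: (@card_initial k x).
  apply: card_le_trans Bx; apply: card_le_trans XB.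
  by rewrite (card_le_eqr Xm).
have [|x F G t e [Xt tP]|F FP] := @transfinite_choice k _ (id, id)
    (fun x (F : k -> (nat -> nat) * (nat -> nat)) t =>
       X t.1 /\ forall y, olt y x -> les (F y).1 t.2 /\ ~ les t.1 (F y).2).
- move=> x F HF.
  have [||g gP] := bounded x ((fst \o F) @` [set y | olt y x]).
  + by move=> _ [y /HF[XF _] <-].
  + exact: card_image_le.
  have [|f Xf fP] := ncov x (fun y => [set f | X f /\ les f (F y).2]).
    move=> y yx; split=> [f [] //|]; apply/XP; first by move=> f [].
    by exists (F y).2 => f [].
  exists (f, g); split=> // y yx; split; first by apply: gP; exists y.
  by move=> fF; exact: (fP y yx).
- by split=> // y yx; rewrite -e //; exact: tP.
apply: (interleaved_scales_refute kinf (f := fst \o F) (g := snd \o F)).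
by move=> x y xy; exact: (FP y).2 x xy.
Qed.

(** * Suprema of sets of cardinals *)

Lemma cle_trans (l k m : Card) : cle k l -> cle l m -> cle k m.
Proof. exact: card_le_trans. Qed.

Lemma clt_cle (k l : Card) : clt k l -> cle k l.
Proof. by move=> nlk; have [|/nlk] := card_le_total [set: k] [set: l]. Qed.

Lemma attained_max (P : set Card) :
  attained P -> exists2 k, P k & forall l, P l -> cle l k.
Proof.
move=> [k [Pk kmax]]; exists k => // l /kmax nkl.
by apply: contrapT => nlk; exact: nkl.
Qed.

(** The set [T] bounds the cardinals in [P] and thereby makes the supremum of
    [P] meaningful. *)
Lemma card_sup_bounds T (P : set Card) (k : Card) :
  (forall l, P l -> [set: l] #<= [set: T]) ->
  (forall l, P l -> ~ cle k l) ->
  cle (card_sup P) k /\ (attained P -> clt (card_sup P) k).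
Proof.
move=> PT Pk; have [supP supmin] := card_supP PT; split=> [|/attained_max[l Pl lmax]].
  by apply: supmin => l /Pk; exact: clt_cle.
by move=> kP; apply: (Pk l Pl); apply: cle_trans kP (supmin _ _).
Qed.

Lemma S_up_bounded l : S_up l -> [set: l] #<= [set: nat -> nat].
Proof.
move=> [C [_ _ lC]]; rewrite (card_le_eql lC).
by apply: card_le_trans (cf_le (fun f _ => les_refl f)) (card_leT _).
Qed.

Lemma S_h_bounded l : S_h l -> [set: l] #<= [set: nat -> nat].
Proof. by move=> [X [Xl _]]; rewrite -(card_le_eql Xl); exact: card_leT. Qed.

Lemma S_up_bounds (k : Card) : infinite_set [set: k] -> Cs k \/ Cs_hat k ->
  cle b_up k /\ (attained S_up -> clt b_up k).
Proof.
move=> kinf Ck; apply: card_sup_bounds S_up_bounded _ => l Sl kl.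
by have [] := S_up_refutes kinf Sl kl; case: Ck.
Qed.

Lemma regular_cle_ocf (l : Card) : regular l -> cle l (ocf l).
Proof. by move=> [_ /card_eqPle[]]. Qed.

Lemma b_h_le (k : Card) : infinite_set [set: k] ->
  cofinal_in cle S_h (S_h `&` Reg) -> Cs k \/ Cs_hat k -> cle b_h k.
Proof.
move=> kinf [_ cof] Ck; apply: (card_supP S_h_bounded).2 => l Sl.
have [m [Sm regm] lm] := cof l Sl; apply: cle_trans lm _; apply: contrapT => nmk.
have km : cle k m by exact: clt_cle.
have kcf := cle_trans km (regular_cle_ocf regm).
by have [] := S_h_refutes kinf Sm (card_eqxx _) km kcf; case: Ck.
Qed.

Lemma b_h_lt (k : Card) : infinite_set [set: k] ->
  regular b_h -> attained S_h -> Cs k \/ Cs_hat k -> clt b_h k.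
Proof.
move=> kinf reg /attained_max[l Sl lmax] Ck kb.
have [supP supmin] := card_supP S_h_bounded.
have lb : ceq l b_h by apply/card_eqPle; split; [exact: supP|exact: supmin].
by have [] := S_h_refutes kinf Sl lb kb (cle_trans kb (regular_cle_ocf reg)); case: Ck.
Qed.

(** * Hereditarily countable sets *)

Lemma hc_eq_refl x : hc_eq x x.
Proof. by elim: x => D f IH; split=> n Dn; exists n, Dn; exact: IH. Qed.

Lemma hc_eq_sym x y : hc_eq x y -> hc_eq y x.
Proof.
elim: x y => D f IH [E g] [DE ED]; split=> [m Em|n Dn].
  by have [n [Dn /IH]] := ED m Em; exists n, Dn.
by have [m [Em /IH]] := DE n Dn; exists m, Em.
Qed.

Lemma hc_eq_trans y x z : hc_eq x y -> hc_eq y z -> hc_eq x z.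
Proof.
elim: x y z => D f IH [E g] [F h] [DE ED] [EF FE]; split=> [n Dn|l Fl].
  have [m [Em fg]] := DE n Dn; have [l [Fl gh]] := EF m Em.
  by exists l, Fl; exact: IH fg gh.
have [m [Em gh]] := FE l Fl; have [n [Dn fg]] := ED m Em.
by exists n, Dn; exact: IH fg gh.
Qed.

Lemma hc_in_eql x x' y : hc_eq x x' -> hc_in x y -> hc_in x' y.
Proof.
case: y => E g xx' [m [Em xg]]; exists m, Em.
exact: hc_eq_trans (hc_eq_sym xx') xg.
Qed.

Lemma hc_in_eqr x y y' : hc_eq y y' -> hc_in x y -> hc_in x y'.
Proof.
case: y y' => [E g] [F h] [EF _] [m [Em xg]].
have [l [Fl gh]] := EF m Em; exists l, Fl; exact: hc_eq_trans xg gh.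
Qed.

Lemma hc_ext x y : (forall z, hc_in z x <-> hc_in z y) -> hc_eq x y.
Proof.
case: x y => [D f] [E g] ext; split=> [n Dn|m Em].
  by apply/(ext (f n Dn)); exists n, Dn; exact: hc_eq_refl.
have [n [Dn gf]] : hc_in (g m Em) (HCset f).
  by apply/(ext (g m Em)); exists m, Em; exact: hc_eq_refl.
by exists n, Dn; exact: hc_eq_sym.
Qed.

Lemma hc_in_irrefl x : ~ hc_in x x.
Proof.
elim: x => D f IH [n [Dn e]]; apply: (IH n Dn).
apply: (hc_in_eqr e); apply: (hc_in_eql e); exists n, Dn; exact: e.
Qed.

Lemma hc_in_upair z x y : hc_in z (hc_upair x y) <-> hc_eq z x \/ hc_eq z y.
Proof.
split=> [[[|n] [_ e]]|[e|e]]; [by left|by right|by exists 0, I|by exists 1, I].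
Qed.

Lemma hc_upair_inj x y x' y' : hc_eq (hc_upair x y) (hc_upair x' y') ->
  hc_eq x x' /\ hc_eq y y' \/ hc_eq x y' /\ hc_eq y x'.
Proof.
move=> e.
have inl z : hc_eq z x \/ hc_eq z y -> hc_eq z x' \/ hc_eq z y'.
  by move=> /hc_in_upair/(hc_in_eqr e)/hc_in_upair.
have inr z : hc_eq z x' \/ hc_eq z y' -> hc_eq z x \/ hc_eq z y.
  by move=> /hc_in_upair/(hc_in_eqr (hc_eq_sym e))/hc_in_upair.
have [xx'|xy'] := inl x (or_introl (hc_eq_refl x)).
  have [yx'|yy'] := inl y (or_intror (hc_eq_refl y)); last by left.
  have [y'x|y'y] := inr y' (or_intror (hc_eq_refl y')); left; split=> //.
    exact: hc_eq_trans yx' (hc_eq_trans (hc_eq_sym xx') (hc_eq_sym y'x)).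
  exact: hc_eq_sym.
have [yx'|yy'] := inl y (or_intror (hc_eq_refl y)); first by right.
have [x'x|x'y] := inr x' (or_introl (hc_eq_refl x')).
  by left; split=> //; exact: hc_eq_sym.
by right; split=> //; exact: hc_eq_sym.
Qed.

Lemma hc_upair_eq x y x' y' : hc_eq x x' -> hc_eq y y' ->
  hc_eq (hc_upair x y) (hc_upair x' y').
Proof.
move=> xx' yy'; apply: hc_ext => z; rewrite !hc_in_upair.
by split=> -[e|e]; [left|right|left|right]; apply: hc_eq_trans e _ => //;
  exact: hc_eq_sym.
Qed.

Lemma hc_pair_eq x y x' y' : hc_eq x x' -> hc_eq y y' ->
  hc_eq (hc_pair x y) (hc_pair x' y').
Proof. by move=> xx' yy'; do 2?apply: hc_upair_eq. Qed.

Lemma hc_pair_inj x y x' y' :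
  hc_eq (hc_pair x y) (hc_pair x' y') -> hc_eq x x' /\ hc_eq y y'.
Proof.
move=> /hc_upair_inj[[/hc_upair_inj ex /hc_upair_inj ey]|
                     [/hc_upair_inj ex /hc_upair_inj ey]].
  have xx' : hc_eq x x' by case: ex => -[].
  split=> //; case: ey => -[] // xy' yx'.
  exact: hc_eq_trans yx' (hc_eq_trans (hc_eq_sym xx') xy').
have xx' : hc_eq x x' by case: ex => -[].
have xy' : hc_eq x y' by case: ex => -[].
have yx' : hc_eq y x' by case: ey => -[].
by split=> //; exact: hc_eq_trans yx' (hc_eq_trans (hc_eq_sym xx') xy').
Qed.

Lemma hc_in_succ z x : hc_in z (hc_succ x) <-> hc_eq z x \/ hc_in z x.
Proof.
case: x => D f; split=> [[[|n] [Dn e]]|[e|[n [Dn e]]]].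
- by left.
- by right; exists n, Dn.
- by exists 0, I.
- by exists n.+1, Dn.
Qed.

Lemma hc_in_nat z n : hc_in z (hc_nat n) <-> exists2 m, (m < n)%N & hc_eq z (hc_nat m).
Proof.
elim: n => [|n IH]; first by split=> [[? []]|[]].
rewrite /hc_nat iterS -/(hc_nat n) hc_in_succ IH; split.
  by move=> [e|[m mn e]]; [exists n|exists m => //; exact: ltnW].
move=> [m]; rewrite ltnS leq_eqVlt => /orP[/eqP->|mn] e; first by left.
by right; exists m.
Qed.

(** If [m < n], then [m] belongs to [n], so equality of the two would contradict
    foundation. *)
Lemma hc_nat_inj m n : hc_eq (hc_nat m) (hc_nat n) -> m = n.
Proof.
wlog mn : m n / (m <= n)%N => [wlg|] e.
  have [/wlg|/ltnW/wlg H] := leqP m n; first exact.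
  by apply/esym/H/hc_eq_sym.
move: mn; rewrite leq_eqVlt => /orP[/eqP//|mn]; case: (@hc_in_irrefl (hc_nat m)).
by apply: (hc_in_eqr (hc_eq_sym e)); apply/hc_in_nat; exists m => //; exact: hc_eq_refl.
Qed.

Lemma hc_in_natE m n : hc_in (hc_nat m) (hc_nat n) <-> (m < n)%N.
Proof.
rewrite hc_in_nat; split=> [[l ln /hc_nat_inj->//]|mn].
by exists m => //; exact: hc_eq_refl.
Qed.

Lemma hc_in_subset z A : hc_in z (hc_subset A) <-> exists2 n, A n & hc_eq z (hc_nat n).
Proof. by split=> [[n [An e]]|[n An e]]; [exists n|exists n, An]. Qed.

Lemma hc_subset_inj A B : hc_eq (hc_subset A) (hc_subset B) -> A = B.
Proof.
suff sub A' B' : hc_eq (hc_subset A') (hc_subset B') -> A' `<=` B'.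
  by move=> e; apply/seteqP; split; apply: sub => //; exact: hc_eq_sym.
move=> e n An; have : hc_in (hc_nat n) (hc_subset B').
  by apply: (hc_in_eqr e); apply/hc_in_subset; exists n => //; exact: hc_eq_refl.
by move=> /hc_in_subset[m Bm /hc_nat_inj->].
Qed.

Definition hc_omega : HC := hc_subset setT.

Lemma hc_in_omega z : hc_in z hc_omega <-> exists n, hc_eq z (hc_nat n).
Proof. by rewrite hc_in_subset; split=> -[n]; exists n. Qed.

Lemma hc_sub_omega y : (forall u, hc_in u y -> hc_in u hc_omega) ->
  hc_eq y (hc_subset [set n | hc_in (hc_nat n) y]).
Proof.
move=> yw; apply: hc_ext => z; rewrite hc_in_subset; split=> [zy|[n ny e]].
  by have /hc_in_omega[n e] := yw z zy; exists n => //; exact: hc_in_eql e zy.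
exact: hc_in_eql (hc_eq_sym e) ny.
Qed.

Lemma hc_in_tuple z s : hc_in z (hc_tuple s) <->
  exists2 i, (i < size s)%N & hc_eq z (hc_pair (hc_nat i) (hc_subset (nth set0 s i))).
Proof. by split=> [[n [An e]]|[n An e]]; [exists n|exists n, An]. Qed.

Lemma hc_pair_in_tuple x y s : hc_in (hc_pair x y) (hc_tuple s) <->
  exists i, [/\ (i < size s)%N, hc_eq x (hc_nat i) & hc_eq y (hc_subset (nth set0 s i))].
Proof.
rewrite hc_in_tuple; split=> [[i si /hc_pair_inj[]]|[i [si xi yi]]].
  by exists i.
by exists i => //; exact: hc_pair_eq.
Qed.

(** * Definability *)

Definition scons (x : HC) (e : nat -> HC) (n : nat) : HC := if n is m.+1 then e m else x.

Lemma sat_hc_eq p e e' : (forall n, hc_eq (e n) (e' n)) -> sat e p <-> sat e' p.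
Proof.
elim: p e e' => [i j|i j|p IH|p IHp q IHq|p IH] e e' ee' /=.
- split=> H; [apply: (hc_in_eql (ee' i)); exact: hc_in_eqr (ee' j) H|].
  by apply: (hc_in_eql (hc_eq_sym (ee' i))); exact: hc_in_eqr (hc_eq_sym (ee' j)) H.
- split=> H; first exact: hc_eq_trans (hc_eq_sym (ee' i)) (hc_eq_trans H (ee' j)).
  exact: hc_eq_trans (ee' i) (hc_eq_trans H (hc_eq_sym (ee' j))).
- by rewrite (IH e e').
- by rewrite (IHp e e') // (IHq e e').
- have ext x n : hc_eq (scons x e n) (scons x e' n) by case: n => //=; exact: hc_eq_refl.
  by split=> H x; have := H x; [apply: (IH _ _ (ext x)).1|apply: (IH _ _ (ext x)).2].
Qed.

Fixpoint rename (r : nat -> nat) (p : form) : form :=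
  match p with
  | FIn i j => FIn (r i) (r j)
  | FEq i j => FEq (r i) (r j)
  | FNot q => FNot (rename r q)
  | FAnd q q' => FAnd (rename r q) (rename r q')
  | FAll q => FAll (rename (fun n => if n is m.+1 then (r m).+1 else 0) q)
  end.

Lemma sat_rename r p e : sat e (rename r p) <-> sat (fun n => e (r n)) p.
Proof.
elim: p r e => [i j|i j|p IH|p IHp q IHq|p IH] r e //=.
- by rewrite IH.
- by rewrite IHp IHq.
- have ext x n : hc_eq (scons x e (if n is m.+1 then (r m).+1 else 0))
                        (scons x (fun n => e (r n)) n) by case: n => *; exact: hc_eq_refl.
  by split=> H x; have := H x; rewrite IH;
    [apply: (sat_hc_eq _ (ext x)).1|apply: (sat_hc_eq _ (ext x)).2].
Qed.

(** A semantic view of formulas: the closure of this class under connectives and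
    quantifiers replaces the writing of formulas with de Bruijn indices. *)
Definition first_order (P : (nat -> HC) -> Prop) : Prop :=
  exists p, forall e, P e <-> sat e p.

Lemma fo_iff P Q : (forall e, P e <-> Q e) -> first_order Q -> first_order P.
Proof. by move=> PQ [p Qp]; exists p => e; rewrite PQ. Qed.

Lemma fo_hc_eq P e e' : first_order P -> (forall n, hc_eq (e n) (e' n)) -> P e -> P e'.
Proof. by move=> [p Pp] ee'; rewrite !Pp; exact: (sat_hc_eq p ee').1. Qed.

Lemma fo_sat (r : nat -> nat) p : first_order (fun e => sat (fun n => e (r n)) p).
Proof. by exists (rename r p) => e; rewrite sat_rename. Qed.

Lemma fo_in i j : first_order (fun e => hc_in (e i) (e j)).
Proof. by exists (FIn i j). Qed.

Lemma fo_eq i j : first_order (fun e => hc_eq (e i) (e j)).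
Proof. by exists (FEq i j). Qed.

Lemma fo_not P : first_order P -> first_order (fun e => ~ P e).
Proof. by move=> [p Pp]; exists (FNot p) => e; rewrite /= Pp. Qed.

Lemma fo_and P Q : first_order P -> first_order Q -> first_order (fun e => P e /\ Q e).
Proof. by move=> [p Pp] [q Qq]; exists (FAnd p q) => e; rewrite /= Pp Qq. Qed.

Lemma fo_or P Q : first_order P -> first_order Q -> first_order (fun e => P e \/ Q e).
Proof.
move=> foP foQ; apply: fo_iff (fo_not (fo_and (fo_not foP) (fo_not foQ))) => e.
by split=> [[?|?] []|/not_andP[/contrapT|/contrapT]] //; [left|right].
Qed.

Lemma fo_imp P Q : first_order P -> first_order Q -> first_order (fun e => P e -> Q e).
Proof.
move=> foP foQ; apply: fo_iff (fo_not (fo_and foP (fo_not foQ))) => e.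
by split=> [PQ [/PQ]//|nPQ Pe]; apply: contrapT => nQ; apply: nPQ.
Qed.

Lemma fo_equiv P Q : first_order P -> first_order Q ->
  first_order (fun e => P e <-> Q e).
Proof. by move=> foP foQ; apply: fo_and; exact: fo_imp. Qed.

Lemma fo_all (P : HC -> (nat -> HC) -> Prop) :
  first_order (fun e => P (e 0) (fun n => e n.+1)) ->
  first_order (fun e => forall x, P x e).
Proof. by move=> [p Pp]; exists (FAll p) => e; split=> H x; apply/(Pp (scons x e))/H. Qed.

Lemma fo_ex (P : HC -> (nat -> HC) -> Prop) :
  first_order (fun e => P (e 0) (fun n => e n.+1)) ->
  first_order (fun e => exists x, P x e).
Proof.
move=> foP; apply: fo_iff (fo_not (fo_all (P := fun x e => ~ P x e) (fo_not foP))) => e.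
by split=> [[x Px] /(_ x)//|/existsNP[x /contrapT]]; exists x.
Qed.

Lemma fo_upair i j k : first_order (fun e => hc_eq (e i) (hc_upair (e j) (e k))).
Proof.
apply: (fo_iff (Q := fun e => forall z,
    hc_in z (e i) <-> hc_eq z (e j) \/ hc_eq z (e k))).
  move=> e; split=> [eq z|H]; last by apply: hc_ext => z; rewrite hc_in_upair.
  rewrite -hc_in_upair; split; apply: hc_in_eqr => //; exact: hc_eq_sym.
by apply: fo_all; apply: fo_equiv; [exact: (fo_in 0 i.+1)|
  apply: fo_or; [exact: (fo_eq 0 j.+1)|exact: (fo_eq 0 k.+1)]].
Qed.

Lemma fo_pair i j k : first_order (fun e => hc_eq (e i) (hc_pair (e j) (e k))).
Proof.
apply: (fo_iff (Q := fun e => exists u, hc_eq u (hc_upair (e j) (e j)) /\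
    exists v, hc_eq v (hc_upair (e j) (e k)) /\ hc_eq (e i) (hc_upair u v))).
  move=> e; split=> [eq|[u [eu [v [ev eq]]]]]; last first.
    exact: hc_eq_trans eq (hc_upair_eq eu ev).
  exists (hc_upair (e j) (e j)); split; first exact: hc_eq_refl.
  by exists (hc_upair (e j) (e k)); split; first exact: hc_eq_refl.
apply: fo_ex; apply: fo_and; first exact: (fo_upair 0 j.+1 j.+1).
apply: (fo_ex (P := fun v e => hc_eq v (hc_upair (e j.+1) (e k.+1)) /\
  hc_eq (e i.+1) (hc_upair (e 0) v))).
by apply: fo_and; [exact: (fo_upair 0 j.+2 k.+2)|exact: (fo_upair i.+2 1 0)].
Qed.

Lemma fo_pair_in i j k : first_order (fun e => hc_in (hc_pair (e i) (e j)) (e k)).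
Proof.
apply: (fo_iff (Q := fun e => exists z, hc_eq z (hc_pair (e i) (e j)) /\ hc_in z (e k))).
  move=> e; split=> [?|[z [eq]]]; last exact: hc_in_eql.
  by exists (hc_pair (e i) (e j)); split=> //; exact: hc_eq_refl.
by apply: fo_ex; apply: fo_and; [exact: (fo_pair 0 i.+1 j.+1)|exact: (fo_in 0 k.+1)].
Qed.

(** Definability allows for a single parameter; two of them can be packed as an
    ordered pair. *)
Definition unpack (i : nat) (P : (nat -> HC) -> Prop) (e : nat -> HC) : Prop :=
  exists u v, hc_eq (e i) (hc_pair u v) /\ P (scons u (scons v e)).

Lemma fo_unpack i P : first_order P -> first_order (unpack i P).
Proof.
move=> foP; apply: (fo_ex (P := fun u e => exists v,
  hc_eq (e i) (hc_pair u v) /\ P (scons u (scons v e)))).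
apply: (fo_ex (P := fun v e => hc_eq (e i.+1) (hc_pair (e 0) v) /\
  P (scons (e 0) (scons v (fun n => e n.+1))))).
apply: fo_and; first exact: (fo_pair i.+2 1 0).
(* Under the two quantifiers, variable 0 is [v] and variable 1 is [u]. *)
have [p Pp] := foP.
apply: fo_iff (fo_sat (fun n => match n with 0 => 1 | 1 => 0 | m => m end) p).
by move=> e; rewrite Pp; apply: sat_hc_eq => -[|[|n]]; exact: hc_eq_refl.
Qed.

Lemma unpackE i P e b c : first_order P -> hc_eq (e i) (hc_pair b c) ->
  unpack i P e <-> P (scons b (scons c e)).
Proof.
move=> foP eb; split=> [[u [v [uv]]]|Pe]; last by exists b, c.
have [bu cv] := hc_pair_inj (hc_eq_trans (hc_eq_sym uv) eb).
by apply: fo_hc_eq foP _ => -[|[|n]] //=; exact: hc_eq_refl.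
Qed.

Lemma fo_triple P i j k : first_order P ->
  first_order (fun e => P (scons (e i) (scons (e j) (fun _ => e k)))).
Proof.
move=> [p Pp].
apply: fo_iff (fo_sat (fun n => match n with 0 => i | 1 => j | _ => k end) p) => e.
by rewrite Pp; apply: sat_hc_eq => -[|[|n]]; exact: hc_eq_refl.
Qed.

Ltac first_order_tac := repeat first
  [ exact: fo_in | exact: fo_eq | exact: fo_pair | exact: fo_pair_in
  | apply: fo_all | apply: fo_ex | apply: fo_equiv | apply: fo_and
  | apply: fo_not | apply: fo_imp ].

(** The internal version of [increasing_tuples], for [w] the set of natural
    numbers.  Having [w] as a parameter spares a definition of the natural
    numbers, whose order is simply membership. *)
Definition increasing_sequence (P : (nat -> HC) -> Prop) (w b x : HC) : Prop :=
  exists n, hc_in n w /\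
    ((forall i, hc_in i n ->
       exists y, (forall u, hc_in u y -> hc_in u w) /\ hc_in (hc_pair i y) x) /\
    ((forall z, hc_in z x -> exists i, hc_in i n /\
       exists y, (forall u, hc_in u y -> hc_in u w) /\ hc_eq z (hc_pair i y)) /\
    ((forall i y y', hc_in (hc_pair i y) x -> hc_in (hc_pair i y') x -> hc_eq y y') /\
    (forall i j y y', hc_in i j -> hc_in (hc_pair i y) x -> hc_in (hc_pair j y') x ->
       ~ hc_eq y y' /\ P (scons y (scons y' (fun _ => b))))))).

Lemma fo_increasing_sequence P : first_order P ->
  first_order (fun e => increasing_sequence P (e 0) (e 1) (e 2)).
Proof.
by move=> foP; rewrite /increasing_sequence; first_order_tac; exact: fo_triple.
Qed.

Definition increasing_tuples (Q : set nat -> set nat -> Prop) : set (seq (set nat)) :=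
  [set s | forall i j, (i < j < size s)%N ->
     nth set0 s i <> nth set0 s j /\ Q (nth set0 s i) (nth set0 s j)].

Lemma increasing_sequenceE P b x : first_order P ->
  increasing_sequence P hc_omega b x <->
  exists2 s, increasing_tuples (fun A B =>
      P (scons (hc_subset A) (scons (hc_subset B) (fun _ => b)))) s &
    hc_eq x (hc_tuple s).
Proof.
move=> foP.
have P_eq y y' z z' : hc_eq y z -> hc_eq y' z' ->
    P (scons y (scons y' (fun _ => b))) -> P (scons z (scons z' (fun _ => b))).
  by move=> yz yz'; apply: fo_hc_eq foP _ => -[|[|n]] //=; exact: hc_eq_refl.
split=> [[n [/hc_in_omega[N nN] [tot [rng [func incr]]]]]|[s sP xs]].
- have ltN i : (i < N)%N -> hc_in (hc_nat i) n.
    by move=> iN; apply: (hc_in_eqr (hc_eq_sym nN)); exact/hc_in_natE.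
  have /choice[A AP] i : exists A, (i < N)%N ->
      hc_in (hc_pair (hc_nat i) (hc_subset A)) x.
    have [iN|_] := ltnP i N; last by exists set0.
    have [y [/hc_sub_omega yw yx]] := tot _ (ltN i iN).
    exists [set n | hc_in (hc_nat n) y] => _.
    by apply: hc_in_eql yx; apply: hc_pair_eq; [exact: hc_eq_refl|].
  have sizeA : size (mkseq A N) = N by rewrite size_mkseq.
  exists (mkseq A N) => [i j|].
    rewrite sizeA => /andP[ij jN]; have iN := ltn_trans ij jN.
    rewrite !nth_mkseq //.
    have [ne PA] := incr _ _ _ _ ((hc_in_natE i j).2 ij) (AP i iN) (AP j jN).
    by split=> // e; apply: ne; rewrite e; exact: hc_eq_refl.
  apply: hc_ext => z; rewrite hc_in_tuple sizeA; split=> [zx|[i iN]].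
    have [i [ni [y [_ ziy]]]] := rng z zx.
    have /hc_in_nat[m mN im] := hc_in_eqr nN ni.
    exists m => //; apply: (hc_eq_trans ziy); apply: hc_pair_eq => //.
    rewrite nth_mkseq //; apply: (func i); first exact: hc_in_eql ziy zx.
    apply: hc_in_eql (AP m mN).
    by apply: hc_pair_eq; [exact: hc_eq_sym|exact: hc_eq_refl].
  by rewrite nth_mkseq // => e; exact: hc_in_eql (hc_eq_sym e) (AP i iN).
have xin i y : hc_in (hc_pair i y) x -> exists m,
    [/\ (m < size s)%N, hc_eq i (hc_nat m) & hc_eq y (hc_subset (nth set0 s m))].
  by move=> /(hc_in_eqr xs)/hc_pair_in_tuple.
have sub_w A u : hc_in u (hc_subset A) -> hc_in u hc_omega.
  by move=> /hc_in_subset[k _ uk]; apply/hc_in_omega; exists k.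
exists (hc_nat (size s)); split.
  by apply/hc_in_omega; exists (size s); exact: hc_eq_refl.
split=> [i /hc_in_nat[m ms im]|].
  exists (hc_subset (nth set0 s m)); split; first exact: sub_w.
  apply: (hc_in_eqr (hc_eq_sym xs)); apply/hc_pair_in_tuple; exists m; split=> //.
  exact: hc_eq_refl.
split=> [z /(hc_in_eqr xs)/hc_in_tuple[m ms zm]|].
  exists (hc_nat m); split; first exact/hc_in_natE.
  by exists (hc_subset (nth set0 s m)); split; first exact: sub_w.
split=> [i y y' /xin[m [ms im ym]] /xin[l [ls il yl]]|].
  have /hc_nat_inj ml := hc_eq_trans (hc_eq_sym im) il.
  by apply: hc_eq_trans ym _; rewrite ml; exact: hc_eq_sym.
move=> i j y y' ij /xin[m [ms im ym]] /xin[l [ls jl yl]].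
have ml : (m < l)%N by apply/hc_in_natE; apply: (hc_in_eqr jl); exact: hc_in_eql im ij.
have [|ne Pml] := sP m l; first by rewrite ml.
split; last exact: P_eq (hc_eq_sym ym) (hc_eq_sym yl) Pml.
move=> yy'; apply/ne/hc_subset_inj.
exact: hc_eq_trans (hc_eq_sym ym) (hc_eq_trans yy' yl).
Qed.

Lemma definable_increasing_tuples P b : first_order P ->
  definable_tuples (increasing_tuples (fun A B =>
    P (scons (hc_subset A) (scons (hc_subset B) (fun _ => b))))).
Proof.
move=> foP; have foI := fo_increasing_sequence foP.
have [p pP] := fo_unpack 1 foI; exists p, (hc_pair hc_omega b) => x.
pose a := hc_pair hc_omega b; pose e : nat -> HC := fun n => if n is 0 then x else a.
have ea : hc_eq (e 1) (hc_pair hc_omega b) by exact: hc_eq_refl.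
by apply: iff_trans (pP e); rewrite (unpackE foI ea) /= increasing_sequenceE.
Qed.

(** * Well-orders of reals definable over the hereditarily countable sets *)

Definition graph_code (f : nat -> nat) : set nat := range (fun n => pickle (n, f n)).

(** The table relating every code of a pair of numbers to this pair: with it as
    a parameter, the function coded by a set of numbers is definable from this
    set, without any arithmetic in the formula. *)
Definition pair_table : HC :=
  @HCset setT (fun c _ => hc_pair (hc_nat c)
    (let p := odflt (0, 0) (unpickle c) in hc_pair (hc_nat p.1) (hc_nat p.2))).

Definition decodes (t y g : HC) : Prop :=
  forall v, hc_in v g <-> exists k, hc_in k y /\ hc_in (hc_pair k v) t.

Lemma hc_in_fun v f :
  hc_in v (hc_fun f) <-> exists n, hc_eq v (hc_pair (hc_nat n) (hc_nat (f n))).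
Proof. by split=> [[n [_ e]]|[n e]]; [exists n|exists n, I]. Qed.

Lemma decodes_graph_code f g :
  decodes pair_table (hc_subset (graph_code f)) g <-> hc_eq g (hc_fun f).
Proof.
have dec v : (exists k, hc_in k (hc_subset (graph_code f)) /\
    hc_in (hc_pair k v) pair_table) <-> hc_in v (hc_fun f).
  rewrite hc_in_fun; split=> [[k [/hc_in_subset[_ [n _ <-] kn]]]|[n vn]].
    move=> [c [_ /hc_pair_inj[kc vc]]]; exists n; move: vc.
    by have /hc_nat_inj <- := hc_eq_trans (hc_eq_sym kn) kc; rewrite pickleK.
  exists (hc_nat (pickle (n, f n))); split.
    by apply/hc_in_subset; exists (pickle (n, f n)); [exists n|exact: hc_eq_refl].
  exists (pickle (n, f n)), I; rewrite pickleK /=.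
  by apply: hc_pair_eq => //; exact: hc_eq_refl.
split=> [gP|e v]; first by apply: hc_ext => v; rewrite gP dec.
by rewrite dec; split; apply: hc_in_eqr => //; exact: hc_eq_sym.
Qed.

(** The relation defined by [p] with parameter [a], pulled back to codes of
    functions along the table [t]. *)
Definition coded_relation (p : form) (t a y y' : HC) : Prop :=
  exists g, decodes t y g /\ exists g', decodes t y' g' /\
    exists z, hc_eq z (hc_pair g g') /\ sat (scons z (fun _ => a)) p.

Lemma fo_coded_relation p :
  first_order (fun e => coded_relation p (e 0) (e 1) (e 2) (e 3)).
Proof.
rewrite /coded_relation /decodes; first_order_tac.
(* Under the three quantifiers, [z] is variable 0 and [a] is variable 1 + 3. *)
apply: fo_iff (fo_sat (fun n => if n is 0 then 0 else 4) p) => e.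
by apply: sat_hc_eq => -[|n]; exact: hc_eq_refl.
Qed.

Lemma coded_relationE p a f f' :
  coded_relation p pair_table a (hc_subset (graph_code f)) (hc_subset (graph_code f')) <->
  sat (scons (hc_pair (hc_fun f) (hc_fun f')) (fun _ => a)) p.
Proof.
split=> [[g [/decodes_graph_code gf [g' [/decodes_graph_code gf' [z [zg]]]]]]|H].
  apply: (sat_hc_eq p _).1 => -[|n] /=; last exact: hc_eq_refl.
  by apply: hc_eq_trans zg _; exact: hc_pair_eq.
exists (hc_fun f); split; first by apply/decodes_graph_code; exact: hc_eq_refl.
exists (hc_fun f'); split; first by apply/decodes_graph_code; exact: hc_eq_refl.
by exists (hc_pair (hc_fun f) (hc_fun f')); split; first exact: hc_eq_refl.
Qed.

Lemma stationary_increasing_choice (k : Card) n (S : 'I_n -> set k) :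
  infinite_set [set: k] -> (forall i, stationary (S i)) ->
  exists x : nat -> k, (forall i j, (i < j)%N -> olt (x i) (x j)) /\
    forall i : 'I_n, S i (x i).
Proof.
move=> kinf; case: n S => [|n] S statS.
  have [x0 _] := infinite_setN0 kinf.
  have /choice[next nextP] x : exists y : k, olt x y := infinite_card_no_max x kinf.
  exists (fun i => iter i next x0); split=> [|[]//].
  by apply: homo_ltn => [y x z|i]; [exact: olt_trans|exact: nextP].
have [x0 _] := infinite_setN0 kinf.
have /choice[next nextP] (p : 'I_n.+1 * k) : exists y, S p.1 y /\ olt p.2 y.
  by have [y] := stationary_unbounded p.2 kinf (statS p.1); exists y.
pose x := fix x i := next (inord i, if i is j.+1 then x j else x0).
exists x; split=> [|i].
  apply: homo_ltn => [y z t|i]; first exact: olt_trans.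
  exact: (nextP (inord i.+1, x i)).2.
rewrite -[X in S X]inord_val.
case: (val i) => [|j]; first exact: (nextP (inord 0, x0)).1.
exact: (nextP (inord j.+1, x j)).1.
Qed.

(** A strictly increasing [k]-sequence of reals is coded by subsets of [nat];
    the set refuting the principle consists of the increasing sequences of
    codes.  A stationary set contains a decreasing pair, while increasing
    sequences can be chosen across any finite family of stationary sets. *)
Lemma DO_refutes (k l : Card) : infinite_set [set: k] -> DO l -> cle k l -> ~ HP k.
Proof.
move=> kinf [X [R [o [[[p [a Rp]] _] _ [h [_ hR]] lo]]]] kl HPk.
have [x0 _] := infinite_setN0 kinf.
have ko : cle k (ocf o) by rewrite /cle -(card_le_eqr lo).
have [F FP] := cf_sequence (fun (x : o) _ => ole_refl x) ko (inhabits x0).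
pose r x := graph_code (h (F x)).
pose b := hc_pair pair_table a.
(* The parameter [b] is variable 2 and unpacks to [pair_table] and [a]. *)
pose P := unpack 2 (fun e => coded_relation p (e 0) (e 1) (e 2) (e 3)).
have foP : first_order P by apply: fo_unpack; exact: fo_coded_relation.
have PE x y : P (scons (hc_subset (r x)) (scons (hc_subset (r y)) (fun _ => b))) <->
    olt x y.
  pose e := scons (hc_subset (r x)) (scons (hc_subset (r y)) (fun _ => b)).
  have eb : hc_eq (e 2) (hc_pair pair_table a) by exact: hc_eq_refl.
  apply: iff_trans (unpackE (fo_coded_relation p) eb) _.
  rewrite /= coded_relationE; apply: iff_trans (iff_sym (Rp _)) _.
  rewrite -[R _]/(rel_on_reals R (h (F x)) (h (F y))) -hR; split=> [lt|xy].
    apply/oltNge => yx; have [e'|/((FP x).2 y)] := ole_eqVlt yx.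
      by move: lt; rewrite e' => -[].
    by apply; have [] := lt.
  by apply/oltNge; exact: (FP y).2.
have r_inj : injective r.
  move=> x y e; apply: contrapT => /olt_neq_total[xy|xy]; move: (xy) => /PE.
    by rewrite e => /PE[].
  by rewrite e => /PE[].
have [] := HPk r _ _ (definable_increasing_tuples b foP).
- move=> s sA; apply/(uniqP set0) => i j; rewrite !inE => si sj e.
  case: (ltngtP i j) => // ij.
    by have [|/(_ e)] := sA i j; first exact/andP.
  by have [|/(_ (esym e))] := sA j i; first exact/andP.
- move=> [S [statS HS]].
  have [x Sx _] := stationary_unbounded x0 kinf statS.
  have [y Sy xy] := stationary_unbounded x kinf statS.
  have [//||z|_ /PE yx] := HS [:: r y; r x] _ _ _ 0 1 isT.
  + by rewrite /= inE andbT; apply/eqP => /r_inj e; move: xy; rewrite e => -[].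
  + by rewrite !inE => /orP[]/eqP->; [exists y|exists x].
  + by have [_] := olt_trans xy yx.
- move=> [n [_ [S [statS HS]]]].
  have [x [xlt xS]] := stationary_increasing_choice kinf statS.
  have x_inj i j : x i = x j -> i = j.
    by move=> e; case: (ltngtP i j) => // /xlt[_]; rewrite e.
  have nthE i : (i < n)%N -> nth set0 [tuple r (x i) | i < n] i = r (x i).
    by move=> iN; rewrite -[i in LHS]/(val (Ordinal iN)) -tnth_nth tnth_mktuple.
  apply: (HS [tuple r (x i) | i < n]).
  + by rewrite map_inj_uniq ?enum_uniq // => i j /r_inj/x_inj/val_inj.
  + by move=> i; rewrite tnth_mktuple; exists (x i).
  + move=> i j; rewrite size_tuple => /andP[ij jn].
    rewrite !nthE //; last exact: ltn_trans ij jn.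
    split; last exact/PE/xlt.
    by move=> /r_inj/x_inj e; move: ij; rewrite e ltnn.
Qed.

Lemma DO_bounded l : DO l -> [set: l] #<= [set: nat -> nat].
Proof.
move=> [X [R [o [_ [irr _ _ _] [h [hX hR]] lo]]]]; rewrite (card_le_eql lo).
apply: card_le_trans (cf_le (fun x _ => ole_refl x)) _.
apply: (card_leT_inj (f := h)) => x y e; apply: contrapT => /olt_neq_total[] /hR.
  by rewrite e; apply: irr; rewrite -hX; exists y.
by rewrite e; apply: irr; rewrite -hX; exists y.
Qed.

(** * Cardinals satisfying the principles *)

Theorem lemma3p7 (kappa : Card) (hkappa : regular_uncountable kappa) :
  ((has_les_chain kappa -> ~ Cs kappa /\ ~ Cs_hat kappa) /\
   (S_up kappa -> ~ Cs kappa /\ ~ Cs_hat kappa)) /\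
  ((Cs kappa \/ Cs_hat kappa -> cle b_up kappa) /\
   (attained S_up -> Cs kappa \/ Cs_hat kappa -> clt b_up kappa)) /\
  ((exists lambda : Card,
      S_h lambda /\ cle kappa lambda /\ cle kappa (ocf lambda)) ->
     ~ Cs kappa /\ ~ Cs_hat kappa) /\
  ((cofinal_in cle S_h (S_h `&` Reg) ->
      Cs kappa \/ Cs_hat kappa -> cle b_h kappa) /\
   (regular b_h -> attained S_h ->
      Cs kappa \/ Cs_hat kappa -> clt b_h kappa)) /\
  (DO kappa -> ~ HP kappa) /\
  ((HP kappa -> cle do_sup kappa) /\
   (attained DO -> HP kappa -> clt do_sup kappa)).
Proof.
have kinf := hkappa.1.1.
have do_bounds : HP kappa ->
    cle do_sup kappa /\ (attained DO -> clt do_sup kappa).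
  move=> HPk; apply: card_sup_bounds DO_bounded _ => l Dl kl.
  exact: DO_refutes kinf Dl kl HPk.
split; first split.
- exact: chain_refutes.
- by move=> Sk; exact: S_up_refutes kinf Sk (card_lexx _).
split; first split.
- by move=> /(S_up_bounds kinf)[].
- by move=> att /(S_up_bounds kinf)[_]; exact.
split.
  by move=> [l [Sl [kl kcf]]]; exact: S_h_refutes kinf Sl (card_eqxx _) kl kcf.
split; first by split; [exact: b_h_le|exact: b_h_lt].
split; first by move=> Dk; exact: DO_refutes kinf Dk (card_lexx _).
by split=> [/do_bounds[]//|att /do_bounds[_]]; exact.
Qed.
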